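(* Let $n,d\in\mathbb{N}$ and let $\mathsf{A}_{n,d}=\{x^\alpha\mid\alpha\in\mathbb{N}_0^n,\ |\alpha|\leq d\}$ be the monomials of degree at most $d$ in $n$ variables. Then for Gaussian mixtures (with $\mathcal{X}=\mathbb{R}^n$) and for log-normal mixtures (with $\mathcal{X}=(0,\infty)^n$) we have \[\mathcal{C}^M_{\mathsf{A}_{n,d}}\leq\mathcal{C}_{\mathsf{A}_{n,d}},\] where in each case both numbers are taken with respect to the corresponding $\mathcal{X}$.
   Context: Parameters: $\Sigma\subset\mathbb{R}^{n\times n}$ is the set of all symmetric non-singular matrices, $\lambda^n$ is the $n$-dimensional Lebesgue measure. Gaussian measures: for $\xi\in\mathcal{X}=\mathbb{R}^n$, $\sigma\in\Sigma$, $\delta_{\xi,\sigma}=\delta^G_{\xi,\sigma}$ has $\lambda^n$-density $\frac{\exp\left(-\frac12(x-\xi)^T\sigma^{-2}(x-\xi)\right)}{\sqrt{(2\pi)^n\det(\sigma)^2}}$ on $\mathbb{R}^n$. Log-normal measures: for $\xi\in\mathcal{X}=(0,\infty)^n$, $\sigma\in\Sigma$, $\delta_{\xi,\sigma}=\delta^L_{\xi,\sigma}$ has $\lambda^n$-density $\frac{\exp\left(-\frac12(\log x-\log\xi)^T\sigma^{-2}(\log x-\log\xi)\right)}{\sqrt{(2\pi)^n\det(\sigma)^2}\,\prod_{i=1}^n x_i}$ on $(0,\infty)^n$, where $\log x=(\log x_i)_{i=1}^n$. For $\mathsf{A}=\{a_1,\dots,a_m\}$: $s_{\mathsf{A}}(x):=(a_i(x))_{i=1}^m$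 and $t_{\mathsf{A}}(x,\sigma):=\left(\int_{\mathcal{X}} a_i\,\mathrm{d}\delta_{x,\sigma}\right)_{i=1}^m$. Carathéodory number (Dirac measures): the moment cone $\mathcal{S}_{\mathsf{A}}$ is the set of all vectors $\int_{\mathcal{X}} s_{\mathsf{A}}\,\mathrm{d}\mu$, $\mu$ a positive measure on $\mathcal{X}$ with all these integrals finite. For $s\in\mathcal{S}_{\mathsf{A}}$, $\mathcal{C}_{\mathsf{A}}(s)$ is the smallest $k$ with $s=\sum_{i=1}^k c_i\,s_{\mathsf{A}}(x_i)$ for some $c_i\geq0$, $x_i\in\mathcal{X}$, and $\mathcal{C}_{\mathsf{A}}:=\max_{s\in\mathcal{S}_{\mathsf{A}}}\mathcal{C}_{\mathsf{A}}(s)$. Carathéodory number of mixtures: $\mathcal{T}_{\mathsf{A}}:=\{\sum_{i=1}^m c_i\,t_{\mathsf{A}}(x_i,\sigma_i)\mid c_i\geq0,(x_i,\sigma_i)\in\mathcal{X}\times\Sigma\}$. For $s\in\mathcal{T}_{\mathsf{A}}$, $\mathcal{C}^M_{\mathsf{A}}(s)$ is the smallest $k$ with $s=\sum_{i=1}^k c_i\,t_{\mathsf{A}}(x_i,\sigma_i)$ for some $c_i>0$, $(x_i,\sigma_i)\in\mathcal{X}\times\Sigma$, and $\mathcal{C}^M_{\mathsf{A}}:=\max_{s\in\mathcal{T}_{\mathsf{A}}}\mathcal{C}^M_{\mathsf{A}}(s)$. *)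

(* Defs.v *)
From HB Require Import structures.
From mathcomp Require Import all_boot all_order all_algebra.
From mathcomp Require Import all_classical all_reals all_analysis.
From mathcomp Require Import measurable_realfun.
Set Implicit Arguments.
Unset Strict Implicit.
Unset Printing Implicit Defensive.
Import Order.TTheory GRing.Theory Num.Theory.
Import numFieldNormedType.Exports.
Local Open Scope classical_set_scope.
Local Open Scope ring_scope.

(* Points of R^n are [n.-tuple R]; the sigma-algebra of the library on this type
   is the product one, i.e. the Borel sets of R^n. *)

Section tuple_lebesgue.
Context {R : realType}.

Definition tcons n (p : measurableTypeR R * n.-tuple R) : n.+1.-tuple R :=
  [tuple of p.1 :: p.2].

Lemma measurable_tcons n : measurable_fun setT (@tcons n).
Proof. exact: measurable_cons. Qed.

HB.instance Definition _ n :=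
  isMeasurableFun.Build _ _ _ _ (@tcons n) (@measurable_tcons n).

Definition cons_measure n (m : set (n.-tuple R) -> \bar R) :
    set (n.+1.-tuple R) -> \bar R :=
  pushforward (lebesgue_measure \x m)%E (@tcons n).

Section cons_measure.
Variables (n : nat) (m : {sigma_finite_measure set (n.-tuple R) -> \bar R}).

Let cons_measure0 : cons_measure m set0 = 0%E.
Proof. by rewrite /cons_measure /pushforward preimage_set0 measure0. Qed.

Let cons_measure_ge0 A : (0 <= cons_measure m A)%E.
Proof. exact: measure_ge0. Qed.

Let cons_measure_sigma_additive : semi_sigma_additive (cons_measure m).
Proof.
pose mu := pushforward (lebesgue_measure \x m)%E (@tcons n).
exact: (@measure_semi_sigma_additive _ _ _
  (mu : {measure set (n.+1.-tuple R) -> \bar R})).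
Qed.

HB.instance Definition _ := isMeasure.Build _ _ _ (cons_measure m)
  cons_measure0 cons_measure_ge0 cons_measure_sigma_additive.

Let cons_measure_sigma_finite : sigma_finite setT (cons_measure m).
Proof.
have /sigma_finiteP[F [FT ndF Foo]] := sigma_finiteT (@lebesgue_measure R).
have /sigma_finiteP[G [GT ndG Goo]] := sigma_finiteT m.
pose g (t : n.+1.-tuple R) : measurableTypeR R * n.-tuple R :=
  (thead t, [tuple of behead t]).
have Kg : cancel (@tcons n) g.
  by move=> [x t]; rewrite /g /tcons theadE; congr pair; exact: val_inj.
have mg : measurable_fun setT g.
  apply: measurable_fun_pair; first exact: (@measurable_tnth _ _ n.+1 ord0).
  exact: measurable_behead.
exists (fun k => g @^-1` (F k `*` G k)).
  rewrite -preimage_bigcup predeqE => t; split => // _.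
  have [i _ Fi] : (\bigcup_k F k) (g t).1 by rewrite -FT.
  have [j _ Gj] : (\bigcup_k G k) (g t).2 by rewrite -GT.
  exists (maxn i j) => //; split.
  - by move: Fi; exact/subsetPset/ndF/leq_maxl.
  - by move: Gj; exact/subsetPset/ndG/leq_maxr.
move=> k; have [mF Fk] := Foo k; have [mG Gk] := Goo k; split.
  by rewrite -[X in measurable X]setTI; apply: mg => //; exact: measurableX.
rewrite /cons_measure /pushforward -comp_preimage (_ : g \o _ = id).
  by rewrite preimage_id product_measure1E// lte_mul_pinfty// ge0_fin_numE.
exact/funext.
Qed.

HB.instance Definition _ := Measure_isSigmaFinite.Build _ _ _ (cons_measure m)
  cons_measure_sigma_finite.

End cons_measure.

(* n-dimensional Lebesgue measure: the n-fold product of [lebesgue_measure],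
   transported along R * R^n ~ R^(n+1). *)
Fixpoint tuple_lebesgue n : {sigma_finite_measure set (n.-tuple R) -> \bar R} :=
  if n is m.+1 then cons_measure (tuple_lebesgue m)
  else \d_([tuple] : 0.-tuple R).

Lemma measurable_box n (A : 'I_n -> set (measurableTypeR R)) :
  (forall i, measurable (A i)) ->
  measurable [set t : n.-tuple R | forall i, A i (tnth t i)].
Proof.
move=> mA; rewrite (_ : mkset _ =
    \big[setI/setT]_(i < n) ((fun t : n.-tuple R => tnth t i) @^-1` A i)).
  apply: bigsetI_measurable => i _; rewrite -[X in measurable X]setTI.
  by apply: (@measurable_tnth _ R n i) => //; exact: mA.
rewrite predeqE => t; rewrite -bigcap_seq; split=> [At i _|At i].
  exact: At.
exact: (At i (mem_index_enum _)).
Qed.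

Lemma tuple_lebesgue_box n (A : 'I_n -> set (measurableTypeR R)) :
  (forall i, measurable (A i)) ->
  tuple_lebesgue n [set t : n.-tuple R | forall i, A i (tnth t i)] =
  (\prod_(i < n) lebesgue_measure (A i))%E.
Proof.
elim: n A => [A _|n ih A mA].
  by rewrite big_ord0 /= diracE mem_set// => -[].
rewrite big_ord_recl -ih//= /cons_measure /pushforward.
rewrite -product_measure1E//; last first.
  exact: (measurable_box (A := fun i => A (lift ord0 i))).
congr (_ _); rewrite predeqE => -[x t]; split => /= [At|[Ax At] i].
  split=> [|i]; first by have := At ord0.
  by have := At (lift ord0 i); rewrite tnthS.
by have [j ->|->//] := unliftP ord0 i; rewrite tnthS.
Qed.

End tuple_lebesgue.

(* The measure with mu-density f on D, as a measure on the whole space that is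
   carried by D. *)
Definition mdensity d (T : measurableType d) (R : realType)
    (mu : set T -> \bar R) (D : set T) (f : T -> R)
    (mD : measurable D) (mf : measurable_fun D f)
    (f0 : forall x, D x -> 0 <= f x) : set T -> \bar R :=
  fun B => (\int[mu]_(x in B `&` D) (f x)%:E)%E.

Section mdensity.
Context d (T : measurableType d) (R : realType).
Variables (mu : {measure set T -> \bar R}) (D : set T) (f : T -> R).
Hypotheses (mD : measurable D) (mf : measurable_fun D f)
  (f0 : forall x, D x -> 0 <= f x).

Local Notation nu := (mdensity mu mD mf f0).

Let mdensity0 : nu set0 = 0%E.
Proof. by rewrite /mdensity set0I integral_set0. Qed.

Let mdensity_ge0 B : (0 <= nu B)%E.
Proof. by apply: integral_ge0 => x [_ Dx]; rewrite lee_fin f0. Qed.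

Let mdensity_sigma_additive : semi_sigma_additive nu.
Proof.
move=> F mF tF mUF; rewrite /mdensity setI_bigcupl ge0_integral_bigcup//.
- apply: is_cvg_ereal_nneg_natsum_cond => k _ _.
  by apply: integral_ge0 => x [_ Dx]; rewrite lee_fin f0.
- by move=> k; exact: measurableI.
- apply/measurable_EFinP; apply: measurable_funS mf => //.
  by rewrite -setI_bigcupl; exact: subIsetr.
- by move=> x [k _ [_ Dx]]; rewrite lee_fin f0.
- exact: trivIset_setIr.
Qed.

HB.instance Definition _ := isMeasure.Build _ _ _ nu
  mdensity0 mdensity_ge0 mdensity_sigma_additive.

End mdensity.

Section gaussian_lognormal.
Context {R : realType} {n : nat}.
Implicit Types (x xi : n.-tuple R) (sigma : 'M[R]_n).

Definition symmetric_nonsingular : set 'M[R]_n :=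
  [set sigma | sigma^T = sigma /\ sigma \in unitmx].

Definition colv x : 'cV[R]_n := \col_i tnth x i.

Definition tlog x : n.-tuple R := [tuple ln (tnth x i) | i < n].

Definition posorthant : set (n.-tuple R) := [set x | forall i, 0 < tnth x i].

Definition quadform sigma (v : 'cV[R]_n) : R :=
  (v^T *m (invmx sigma *m invmx sigma) *m v) 0 0.

Definition gaussian_pdf xi sigma x : R :=
  expR (- 2^-1 * quadform sigma (colv x - colv xi))
    / Num.sqrt ((2 * pi) ^+ n * \det sigma ^+ 2).

Definition lognormal_pdf xi sigma x : R :=
  expR (- 2^-1 * quadform sigma (colv (tlog x) - colv (tlog xi)))
    / (Num.sqrt ((2 * pi) ^+ n * \det sigma ^+ 2) * \prod_(i < n) tnth x i).

Lemma gaussian_pdf_ge0 xi sigma x : [set: n.-tuple R] x ->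
  0 <= gaussian_pdf xi sigma x.
Proof. by move=> _; rewrite divr_ge0 ?expR_ge0 ?sqrtr_ge0. Qed.

Lemma lognormal_pdf_ge0 xi sigma x : posorthant x ->
  0 <= lognormal_pdf xi sigma x.
Proof.
move=> x0; rewrite divr_ge0 ?expR_ge0 ?mulr_ge0 ?sqrtr_ge0//.
by apply: prodr_ge0 => i _; exact/ltW/x0.
Qed.

Lemma quadformE sigma v :
  quadform sigma v =
  \sum_j (\sum_i v i 0 * (invmx sigma *m invmx sigma) i j) * v j 0.
Proof.
rewrite /quadform mxE; apply: eq_bigr => j _; rewrite mxE; congr (_ * _).
by apply: eq_bigr => i _; rewrite mxE.
Qed.

Let measurable_quadform d (T : measurableType d) sigma (v : T -> 'cV[R]_n) :
  (forall i, measurable_fun setT (fun t => v t i 0)) ->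
  measurable_fun setT (fun t => quadform sigma (v t)).
Proof.
move=> mv; under eq_fun do rewrite quadformE.
apply: measurable_sum => j; apply: measurable_funM => //.
by apply: measurable_sum => i; apply: measurable_funM.
Qed.

Let measurable_coord i : measurable_fun [set: n.-tuple R] (fun x => tnth x i).
Proof. exact: measurable_tnth. Qed.

Lemma measurable_gaussian_pdf xi sigma :
  measurable_fun setT (gaussian_pdf xi sigma).
Proof.
apply: measurable_funM => //; apply: measurableT_comp => //.
apply: measurable_funM => //; apply: measurable_quadform => i.
under eq_fun do rewrite !mxE.
exact: measurable_funB.
Qed.

Lemma measurable_posorthant : measurable posorthant.
Proof.
have -> : posorthant = \big[setI/setT]_(i < n) ((fun x => tnth x i) @^-1` `]0, +oo[).
  rewrite predeqE => x; rewrite -bigcap_seq; split=> [x0 i _|x0 i].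
    by rewrite /= in_itv/= andbT; exact: x0.
  by have := x0 i (mem_index_enum _); rewrite /= in_itv/= andbT.
apply: bigsetI_measurable => i _.
by rewrite -[X in measurable X]setTI; exact: measurable_coord.
Qed.

Lemma measurable_lognormal_pdf xi sigma :
  measurable_fun posorthant (lognormal_pdf xi sigma).
Proof.
have mln i : measurable_fun [set: n.-tuple R] (fun x => ln (tnth x i)).
  exact: (measurableT_comp (@measurable_ln R)).
pose g x : R := expR (- 2^-1 * quadform sigma (colv (tlog x) - colv (tlog xi)))
  / Num.sqrt ((2 * pi) ^+ n * \det sigma ^+ 2)
  * expR (- \sum_(i < n) ln (tnth x i)).
apply: (@eq_measurable_fun _ _ _ _ _ g).
  move=> x /[!inE] x0; rewrite /g /lognormal_pdf.
  rewrite (_ : expR (- \sum_i _) = (\prod_(i < n) tnth x i)^-1).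
    by rewrite -[LHS]mulrA -invfM.
  rewrite expRN expR_sum; congr (_^-1); apply: eq_bigr => i _.
  by rewrite lnK// posrE x0.
apply: measurable_funTS; apply: measurable_funM.
  apply: measurable_funM => //; apply: measurableT_comp => //.
  apply: measurable_funM => //; apply: measurable_quadform => i.
  under eq_fun do rewrite !mxE !tnth_mktuple.
  exact: measurable_funB.
apply: measurableT_comp => //; apply: measurableT_comp => //.
exact: measurable_sum.
Qed.

Definition gaussian_measure xi sigma : {measure set (n.-tuple R) -> \bar R} :=
  mdensity (tuple_lebesgue n) measurableT
    (measurable_gaussian_pdf xi sigma) (gaussian_pdf_ge0 xi sigma).

Definition lognormal_measure xi sigma : {measure set (n.-tuple R) -> \bar R} :=
  mdensity (tuple_lebesgue n) measurable_posorthant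
    (measurable_lognormal_pdf xi sigma) (@lognormal_pdf_ge0 xi sigma).

End gaussian_lognormal.

Section caratheodory.
Context {R : realType} {n : nat} {I : finType}.
Local Notation pt := (n.-tuple R).
Variables (X : set pt) (a : I -> pt -> R).
Variable delta : pt -> 'M[R]_n -> {measure set pt -> \bar R}.
Implicit Types (s : I -> R) (x : pt).

Definition moment_vector x : I -> R := fun i => a i x.

Definition mixture_vector x (sigma : 'M[R]_n) : I -> R :=
  fun i => \int[delta x sigma]_(y in X) a i y.

Definition moment_cone : set (I -> R) :=
  [set s | exists mu : {measure set pt -> \bar R},
     (forall i, mu.-integrable X (EFin \o a i)) /\
     (forall i, s i = \int[mu]_(x in X) a i x)].

Definition mixture_cone : set (I -> R) :=
  [set s | exists (c : 'I_#|I| -> R) (x : 'I_#|I| -> pt)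
     (sigma : 'I_#|I| -> 'M[R]_n),
     [/\ forall j, 0 <= c j, forall j, X (x j),
         forall j, symmetric_nonsingular (sigma j) &
         forall i, s i = \sum_j c j * mixture_vector (x j) (sigma j) i]].

Definition dirac_representable s : set nat :=
  [set k | exists (c : 'I_k -> R) (x : 'I_k -> pt),
     [/\ forall j, 0 <= c j, forall j, X (x j) &
         forall i, s i = \sum_j c j * moment_vector (x j) i]].

Definition mixture_representable s : set nat :=
  [set k | exists (c : 'I_k -> R) (x : 'I_k -> pt) (sigma : 'I_k -> 'M[R]_n),
     [/\ forall j, 0 < c j, forall j, X (x j),
         forall j, symmetric_nonsingular (sigma j) &
         forall i, s i = \sum_j c j * mixture_vector (x j) (sigma j) i]].

(* The smallest element of K as an extended real: +oo iff K is empty, so that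
   no existence proof is needed to define the Caratheodory numbers below. *)
Definition least_nat (K : set nat) : \bar R :=
  ereal_inf [set k%:R%:E | k in K].

Lemma least_natE (K : set nat) (k : nat) :
  K k -> (forall j, K j -> (k <= j)%N) -> least_nat K = k%:R%:E.
Proof.
move=> Kk kK; apply/eqP; rewrite eq_le; apply/andP; split.
  by apply: ereal_inf_lbound; exists k.
by apply: le_ereal_inf_tmp => _ [j Kj <-]; rewrite lee_fin ler_nat kK.
Qed.

(* The maximum over the cone is taken as a supremum in \bar R: the value is the
   maximum when the latter exists, and +oo when the numbers are unbounded. *)
Definition caratheodory : \bar R :=
  ereal_sup [set least_nat (dirac_representable s) | s in moment_cone].

Definition mixture_caratheodory : \bar R :=
  ereal_sup [set least_nat (mixture_representable s) | s in mixture_cone].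

End caratheodory.

Section monomials.
Context {R : realType} {n d : nat}.

Definition multiindex : Type :=
  {alpha : {ffun 'I_n -> 'I_d.+1} | (\sum_(i < n) alpha i <= d)%N}.

Definition monomial (alpha : multiindex) (x : n.-tuple R) : R :=
  \prod_(i < n) tnth x i ^+ val alpha i.

End monomials.
Arguments multiindex : clear implicits.

(* Main.v *)
Require Import Defs.
From HB Require Import structures.
From mathcomp Require Import all_boot all_order all_algebra.
From mathcomp Require Import all_classical all_reals all_analysis.
From mathcomp Require Import measurable_realfun ring lra.
Set Implicit Arguments.
Unset Strict Implicit.
Unset Printing Implicit Defensive.
Import Order.TTheory GRing.Theory Num.Theory.
Import numFieldNormedType.Exports.
Local Open Scope classical_set_scope.
Local Open Scope ring_scope.

(* Let [T_e] be the linear map on moment vectors sending the vector of the point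
   [x] to the moments of the mixture component at [x] with covariance parameter
   [e I]; it tends to the identity as [e -> 0].  The moment vector of every
   component is an interior point of the moment cone, since its density is
   bounded away from [0] on a cube and can be perturbed there.  Hence, for [s] in
   the mixture cone, the preimage of [s] under [T_e] lies in the moment cone for
   small [e], and a representation of this preimage by [k] Dirac measures is
   mapped by [T_e] to a representation of [s] by [k] components, all of them
   with the same parameter [e I]. *)

(** [T_e] exists because of the monomials: for the parameter [e I] the coordinates decouple, and the
    [k]-th moment in one coordinate is a polynomial of degree at most [k] in that coordinate of the
    point, with coefficients depending only on [e] and [k]. Every multi-index that occurs for
    [alpha] is coordinatewise at most [alpha], so the total degree stays at most [d].

    The given components have arbitrary covariance parameters, and their moments are never computed:
    only integrability of the monomials and a lower bound of the density on a cube enter. The vector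
    [s] itself may lie on the boundary of the moment cone (for instance [s = 0]), so the inverse of
    [T_e] is applied to each component separately and the results are recombined by convexity. The
    cube is [[1, 2]^n] because it lies in both spaces and [ln] is bounded on it. *)

(** * Matrices near the identity, and convexity of the moment cone *)

(** In the l1 norm, [M - 1] has norm at most [eta * #|I| <= 1/2], so the norm of [v] is at most
    twice that of [M v]. This gives injectivity, hence invertibility, and then bounds
    [v - t = v - M v] in terms of [t]. *)
Lemma near_identity_solve (R : realFieldType) (I : finType) (M : I -> I -> R)
    (eta : R) :
  (forall i j, `|M i j - (i == j)%:R| <= eta) -> eta * #|I|%:R <= 2^-1 ->
  forall t : I -> R, exists2 v : I -> R,
    (forall i, t i = \sum_j M i j * v j) &
    (forall i, `|v i - t i| <= 2 * eta * \sum_j `|t j|).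
Proof.
move=> Meta etaI t.
have defect v i : `|v i - \sum_j M i j * v j| <= eta * \sum_j `|v j|.
  rewrite {1}(_ : v i = \sum_j (i == j)%:R * v j); last first.
    rewrite (bigD1 i)//= eqxx mul1r big1 ?addr0// => j.
    by rewrite eq_sym => /negbTE ->; rewrite mul0r.
  rewrite -sumrB mulr_sumr; apply: (le_trans (ler_norm_sum _ _ _)).
  apply: ler_sum => j _; rewrite -mulrBl normrM distrC.
  by rewrite ler_wpM2r.
have bound v : \sum_i `|v i| <= 2 * \sum_i `|\sum_j M i j * v j|.
  have : \sum_i `|v i| <= \sum_i `|\sum_j M i j * v j| +
      \sum_(i : I) eta * \sum_j `|v j|.
    rewrite -big_split/=; apply: ler_sum => i _; rewrite addrC -lerBlDr.
    exact: le_trans (lerB_dist _ _) (defect v i).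
  rewrite sumr_const -[X in _ + X]mulr_natr mulrAC.
  have : 0 <= \sum_i `|v i| by apply: sumr_ge0.
  move: (\sum_i `|v i|) (\sum_i `|_|) => a b a0 ab; nra.
pose B : 'M[R]_#|I| := \matrix_(j, i) M (enum_val i) (enum_val j).
(* [B] is the transpose of [M]: row vectors times [B] compute [M w], which suits the row-freeness
   criterion for invertibility. *)
have BE (w : 'rV[R]_#|I|) i :
    (w *m B) 0 (enum_rank i) = \sum_j M i j * w 0 (enum_rank j).
  rewrite mxE (reindex enum_rank)/=; last first.
    by exists enum_val => ? _; rewrite ?enum_rankK ?enum_valK.
  by apply: eq_bigr => j _; rewrite mxE !enum_rankK mulrC.
have uB : B \in unitmx.
  rewrite -row_free_unit; apply: inj_row_free => w wB.
  have := bound (fun i => w 0 (enum_rank i)).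
  rewrite [X in _ <= _ * X]big1 ?mulr0; last first.
    by move=> i _; rewrite -BE wB mxE normr0.
  move=> w0; apply/rowP => k; rewrite mxE -(enum_valK k).
  apply/eqP; rewrite -normr_eq0 eq_le normr_ge0 andbT.
  apply: le_trans w0; rewrite (bigD1 (enum_val k))//= lerDl.
  by apply: sumr_ge0.
pose v i := ((\row_k t (enum_val k)) *m invmx B) 0 (enum_rank i).
have vE i : t i = \sum_j M i j * v j.
  by rewrite -BE mulmxKV// mxE enum_rankK.
exists v => // i; rewrite {1}vE; apply: (le_trans (defect v i)).
rewrite (mulrC 2) -mulrA ler_wpM2l//.
  by apply: le_trans (Meta i i); exact: normr_ge0.
apply: (le_trans (bound v)).
by under [X in _ * X <= _]eq_bigr do rewrite -vE.
Qed.

Section moment_cone_convex.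
Context {R : realType} {n : nat} {I : finType}.
Variables (X : set (n.-tuple R)) (a : I -> n.-tuple R -> R).
Hypotheses (mX : measurable X) (ma : forall i, measurable_fun X (a i)).
Implicit Types s : I -> R.

Lemma moment_cone0 : moment_cone X a (fun=> 0).
Proof.
exists mzero; split => i; last by rewrite /Rintegral integral_measure_zero.
apply/integrableP; split; first exact/measurable_EFinP.
by rewrite integral_measure_zero ltry.
Qed.

Lemma moment_coneD s1 s2 : moment_cone X a s1 -> moment_cone X a s2 ->
  moment_cone X a (fun i => s1 i + s2 i).
Proof.
move=> [m1 [i1 e1]] [m2 [i2 e2]]; exists (measure_add m1 m2); split => i.
  have [ma1 l1] := integrableP _ _ _ (i1 i).
  have [_ l2] := integrableP _ _ _ (i2 i).
  apply/integrableP; split; first exact/measurable_EFinP.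
  rewrite ge0_integral_measure_add//; first exact: lte_add_pinfty.
  exact: measurableT_comp.
rewrite e1 e2 /Rintegral integral_measure_add//; [|exact: i1|exact: i2].
rewrite [RHS]fineD//; first exact/integrable_fin_num/i1.
exact/integrable_fin_num/i2.
Qed.

Lemma moment_coneZ (c : R) s : 0 <= c -> moment_cone X a s ->
  moment_cone X a (fun i => c * s i).
Proof.
move=> c0 [m [im em]]; exists (mscale (NngNum c0) m).
have iZ i : (mscale (NngNum c0) m).-integrable X (EFin \o a i).
  have [mai li] := integrableP _ _ _ (im i).
  apply/integrableP; split => //.
  rewrite ge0_integral_mscale//; last exact: measurableT_comp.
  by rewrite lte_mul_pinfty//= lee_fin.
split => // i; rewrite em /Rintegral integralE [in RHS]integralE.
have mai : measurable_fun X (EFin \o a i) by exact/measurable_EFinP.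
rewrite !ge0_integral_mscale//=; [|exact: measurable_funeneg|
  exact: measurable_funepos].
have fp := integrable_pos_fin_num mX (im i).
have fn := integrable_neg_fin_num mX (im i).
by rewrite -muleBr ?fin_num_adde_defr// fineM// fin_numB fp fn.
Qed.

Lemma moment_cone_sum m (c : 'I_m -> R) (s : 'I_m -> I -> R) :
  (forall j, 0 <= c j) -> (forall j, moment_cone X a (s j)) ->
  moment_cone X a (fun i => \sum_j c j * s j i).
Proof.
elim: m c s => [|m ih] c s c0 sa.
  by under eq_fun do rewrite big_ord0; exact: moment_cone0.
under eq_fun do rewrite big_ord_recl.
apply: (moment_coneD (s1 := fun i => c ord0 * s ord0 i)).
  exact: moment_coneZ.
exact: (ih (fun j => c (lift ord0 j)) (fun j => s (lift ord0 j))).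
Qed.

End moment_cone_convex.

(** * Comparison of the two Caratheodory numbers *)

Section mixture_le.
Context {R : realType} {n : nat} {I : finType}.
Variables (X : set (n.-tuple R)) (a : I -> n.-tuple R -> R).
Variable delta : n.-tuple R -> 'M[R]_n -> {measure set (n.-tuple R) -> \bar R}.
Hypotheses (mX : measurable X) (ma : forall i, measurable_fun X (a i)).

(** The radius may depend on the component: only finitely many components are handled at a time, so
    no uniformity is asked for. *)
Definition interior_mixtures := forall x sigma, X x ->
  symmetric_nonsingular sigma -> exists2 theta : R, 0 < theta &
    forall s : I -> R,
      (forall i, `|s i - mixture_vector X a delta x sigma i| <= theta) ->
      moment_cone X a s.

(** [M] is the matrix of the map [T_e]. One [sigma] and one [M] serve all points of [X], which is
    what allows a linear relation between moment vectors to be carried over to mixtures. *)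
Definition approximate_diracs := forall eta : R, 0 < eta ->
  exists (sigma : 'M[R]_n) (M : I -> I -> R), [/\ symmetric_nonsingular sigma,
    forall i j, `|M i j - (i == j)%:R| <= eta &
    forall x, X x -> forall i,
      mixture_vector X a delta x sigma i = \sum_j M i j * moment_vector a x j].

(** Dirac representations allow zero weights and mixture representations do not; discarding the zero
    terms can only shorten the sum. *)
Lemma mixture_representable_nneg (s : I -> R) k (c : 'I_k -> R)
    (x : 'I_k -> n.-tuple R) (sigma : 'I_k -> 'M[R]_n) :
  (forall j, 0 <= c j) -> (forall j, X (x j)) ->
  (forall j, symmetric_nonsingular (sigma j)) ->
  (forall i, s i = \sum_j c j * mixture_vector X a delta (x j) (sigma j) i) ->
  exists2 l, (l <= k)%N & mixture_representable X a delta s l.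
Proof.
move=> c0 Xx ssigma sE; pose P := [pred j | 0 < c j].
exists #|P|; first by rewrite -[k in (_ <= k)%N]card_ord max_card.
exists (fun j => c (enum_val j)), (fun j => x (enum_val j)),
  (fun j => sigma (enum_val j)).
split=> // [j|i]; first exact: (enum_valP j).
rewrite sE (bigID P)/= [X in _ + X]big1 ?addr0; last first.
  by move=> j; rewrite lt_neqAle c0 andbT negbK => /eqP <-; rewrite mul0r.
rewrite -(@big_enum_val _ _ _ _ P (fun j =>
  c j * mixture_vector X a delta (x j) (sigma j) i)).
by rewrite big_mkcond [RHS]big_mkcond.
Qed.

Lemma mixture_caratheodory_le : interior_mixtures -> approximate_diracs ->
  (mixture_caratheodory X a delta <= caratheodory X a)%E.
Proof.
move=> interior approx; apply: ge_ereal_sup => _ [s scone <-].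
have [c [x [sigma [c0 Xx ssigma sE]]]] := scone.
have /choice[theta thetaP] (j : 'I_#|I|) : exists theta : R, 0 < theta /\
    forall s, (forall i,
      `|s i - mixture_vector X a delta (x j) (sigma j) i| <= theta) ->
    moment_cone X a s.
  by have [th ? ?] := interior _ _ (Xx j) (ssigma j); exists th.
pose t j := mixture_vector X a delta (x j) (sigma j).
pose N j := \sum_i `|t j i|.
have N0 j : 0 <= N j by apply: sumr_ge0.
have [eta [eta0 etaI etaN]] : exists eta : R, [/\ 0 < eta,
    eta * #|I|%:R <= 2^-1 & forall j, 2 * eta * N j <= theta j].
  (* With [eta = 1 / K], the first summand gives [eta * #|I| <= 1/2], the last one gives
     [2 * eta * N j <= theta j] for all [j] at once, and the [1] keeps [K] positive. *)
  pose K : R := 2 * #|I|%:R + 1 + \sum_j 2 * N j / theta j.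
  have q0 j : 0 <= 2 * N j / theta j.
    by rewrite divr_ge0 ?mulr_ge0// ltW// (thetaP j).1.
  have S0 : 0 <= \sum_j 2 * N j / theta j by apply: sumr_ge0.
  have K0 : 0 < K by rewrite ltr_pwDl// ltr_wpDl// mulr_ge0.
  exists K^-1; split; first by rewrite invr_gt0.
    rewrite mulrC ler_pdivrMr// /K; have : 0 <= #|I|%:R :> R by [].
    by move: S0; move: (\sum_j _) => S; lra.
  move=> j; have th0 := (thetaP j).1.
  rewrite mulrAC ler_pdivrMr// (mulrC (theta j)) -ler_pdivrMr//.
  apply: le_trans (_ : \sum_j 2 * N j / theta j <= K).
    by rewrite (bigD1 j)//= lerDl sumr_ge0.
  by rewrite /K lerDr addr_ge0// mulr_ge0.
have [tau [M [stau Meta ME]]] := approx eta eta0.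
have /choice[v vP] (j : 'I_#|I|) : exists v : I -> R,
    (forall i, t j i = \sum_k M i k * v k) /\
    (forall i, `|v i - t j i| <= 2 * eta * N j).
  by have [v ? ?] := near_identity_solve Meta etaI (t j); exists v.
(* [s'] is the preimage of [s] under [M]. Each [v j] stays in the ball around its own [t j], so
   convexity places [s'] in the moment cone. *)
pose s' i := \sum_j c j * v j i.
have sM i : s i = \sum_k M i k * s' k.
  rewrite sE; under eq_bigr do rewrite -/(t _) (vP _).1 mulr_sumr.
  rewrite exchange_big; apply: eq_bigr => k _; rewrite mulr_sumr.
  by apply: eq_bigr => j _; rewrite mulrCA.
have s'cone : moment_cone X a s'.
  apply: moment_cone_sum => // j; apply: (thetaP j).2 => i.
  exact: le_trans ((vP j).2 i) (etaN j).
apply: le_trans (ereal_sup_ubound _); last by exists s'.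
(* Every length [k] of a Dirac representation of [s'] is shown to bound the mixture number of [s];
   with no such length the right-hand side is [+oo]. *)
apply: le_ereal_inf_tmp => _ [k [d [y [d0 Xy s'E]]] <-].
have [|l lk sl] :=
  @mixture_representable_nneg s k d y (fun=> tau) d0 Xy (fun=> stau).
  move=> i; rewrite sM; under eq_bigr do rewrite s'E mulr_sumr.
  rewrite exchange_big; apply: eq_bigr => j _; rewrite ME// mulr_sumr.
  by apply: eq_bigr => b _; rewrite mulrCA.
apply: (@le_trans _ _ l%:R%:E); last by rewrite lee_fin ler_nat.
by apply: ereal_inf_lbound; exists l.
Qed.

End mixture_le.

(** * Integration with respect to densities and products *)

Section integral_mdensity.
Context d (T : measurableType d) (R : realType).
Variables (mu : {measure set T -> \bar R}) (D : set T) (f : T -> R).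
Hypotheses (mD : measurable D) (mf : measurable_fun D f)
  (f0 : forall x, D x -> 0 <= f x).
Local Notation nu := (mdensity mu mD mf f0).
Local Open Scope ereal_scope.

Import HBNNSimple.

Let mEf : measurable_fun D (EFin \o f). Proof. exact/measurable_EFinP. Qed.

Let integral_mdensity_nnsfun (h : {nnsfun T >-> R}) :
  \int[nu]_(x in D) (h x)%:E = \int[mu]_(x in D) ((h x)%:E * (f x)%:E).
Proof.
transitivity (\int[nu]_(x in D)
    (\sum_(y \in range h) (y * \1_(h @^-1` [set y]) x)%:E)).
  by apply: eq_integral => t tE; rewrite /= fimfunE -fsumEFin.
have indich r : measurable_fun D (fun x => (r * \1_(h @^-1` [set r]) x)%:E).
  by apply: (measurable_comp measurableT) => //; exact: measurable_funM.
rewrite ge0_integral_fsum//; last by move=> y x Dx; exact: nnfun_muleindic_ge0.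
transitivity (\int[mu]_(x in D) (\sum_(y \in range h)
    (y * \1_(h @^-1` [set y]) x)%:E * (f x)%:E)); last first.
  apply: eq_integral => x xD.
  rewrite -ge0_mule_fsuml => [|y]; last exact: nnfun_muleindic_ge0.
  by rewrite fsumEFin // -(fimfunE _ x).
rewrite ge0_integral_fsum//; last 2 first.
- by move=> y; apply: emeasurable_funM.
- by move=> y x Dx; rewrite mule_ge0 ?lee_fin ?f0//; exact: nnfun_muleindic_ge0.
apply: eq_fsbigr => r rh.
under eq_integral do rewrite EFinM.
rewrite integralZl_indic_nnsfun//.
under [RHS]eq_integral do rewrite EFinM -muleA.
rewrite ge0_integralZl//; last 3 first.
- by apply: emeasurable_funM => //; exact/measurable_EFinP.
- by move=> t Dt; rewrite mule_ge0 ?lee_fin ?f0.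
- by move: rh; rewrite inE => -[t _ <-]; rewrite lee_fin.
congr (_ * _).
under [RHS]eq_integral do rewrite muleC.
rewrite [RHS](eq_integral ((EFin \o f) \_ (h @^-1` [set r]))); last first.
  by move=> x xE; rewrite epatch_indic.
(* The measure of a level set is by definition an integral of [f]; the two intersections with [D],
   one from [nu] and one from the domain of integration, collapse into one. *)
rewrite -integral_mkcondr integral_indic// /mdensity/=.
by congr (integral _ _ _); rewrite -setIA setIid setIC.
Qed.

(** Monotone convergence along simple functions increasing to [h]; since [f] is nonnegative, their
    products with [f] increase as well. *)
Lemma ge0_integral_mdensity (h : T -> \bar R) :
  measurable_fun D h -> (forall x, D x -> 0 <= h x) ->
  \int[nu]_(x in D) h x = \int[mu]_(x in D) (h x * (f x)%:E).
Proof.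
move=> mh h0; pose h_ := nnsfun_approx mD mh.
have hE x : D x -> (EFin \o h_ n) x @[n --> \oo] --> h x.
  by move=> Dx; exact: cvg_nnsfun_approx.
transitivity (limn (fun n => \int[nu]_(x in D) (h_ n x)%:E)).
  rewrite -monotone_convergence//=.
  - by apply: eq_integral => x /[!inE] xD; exact/esym/cvg_lim/hE.
  - by move=> n; apply: measurableT_comp => //; exact: measurable_funTS.
  - by move=> n x _; rewrite lee_fin.
  - by move=> x _ a b ab; rewrite lee_fin//; exact/lefP/nd_nnsfun_approx.
under eq_fun do rewrite integral_mdensity_nnsfun.
rewrite -monotone_convergence//=.
- apply: eq_integral => x /[!inE] xD; apply/cvg_lim => //.
  by apply: cvgeZr => //; exact: hE.
- move=> n; apply: emeasurable_funM => //.
  by apply/measurable_EFinP; exact: measurable_funTS.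
- by move=> n x Dx; rewrite mule_ge0 ?lee_fin ?f0.
- move=> x Dx a b ab; rewrite lee_wpmul2r ?lee_fin ?f0//.
  exact/lefP/nd_nnsfun_approx.
Qed.

Lemma integrable_mdensity (h : T -> R) : measurable_fun D h ->
  mu.-integrable D (EFin \o (fun x => h x * f x)%R) ->
  nu.-integrable D (EFin \o h).
Proof.
move=> mh /integrableP[_ hf]; apply/integrableP; split.
  exact/measurable_EFinP.
rewrite ge0_integral_mdensity//; last first.
  by apply: measurableT_comp => //; exact/measurable_EFinP.
apply: le_lt_trans hf; rewrite le_eqVlt; apply/orP; left; apply/eqP.
apply: eq_integral => x /[!inE] Dx /=.
by rewrite -EFinM normrM (ger0_norm (f0 Dx)).
Qed.

Lemma Rintegral_mdensity (h : T -> R) : measurable_fun D h ->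
  mu.-integrable D (EFin \o (fun x => h x * f x)%R) ->
  (\int[nu]_(x in D) h x = \int[mu]_(x in D) (h x * f x))%R.
Proof.
move=> mh hf; have mEh : measurable_fun D (EFin \o h) by exact/measurable_EFinP.
(* As [f] is nonnegative on [D], the positive and negative parts of [h * f] are those of [h] times
   [f]. *)
rewrite /Rintegral integralE [in RHS]integralE; congr (fine (_ - _)).
  rewrite ge0_integral_mdensity//; last exact: measurable_funepos.
  apply: eq_integral => x /[!inE] Dx; rewrite !funeposE /=.
  by rewrite maxe_pMl ?lee_fin ?f0// mul0e EFinM.
rewrite ge0_integral_mdensity//; last exact: measurable_funeneg.
apply: eq_integral => x /[!inE] Dx; rewrite !funenegE /=.
by rewrite maxe_pMl ?lee_fin ?f0// mul0e -EFinM mulNr.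
Qed.

End integral_mdensity.

(** Both spaces have this form, with [D] the line or the open half line; the perturbation of
    densities takes place on the cube over [[1, 2]]. *)
Definition cube {R : realType} n (D : set R) : set (n.-tuple R) :=
  [set t | forall i, D (tnth t i)].
Arguments cube {R} n D _.

Section tuple_lebesgue_product.
Context {R : realType}.
Local Notation leb := (@lebesgue_measure R).

Lemma measurable_cube n (D : set R) : measurable D -> measurable (cube n D).
Proof. by move=> mD; exact: (@measurable_box _ n (fun=> D)). Qed.

Lemma measurable_prod_tnth n (f : 'I_n -> R -> R) :
  (forall i, measurable_fun setT (f i)) ->
  measurable_fun setT (fun t : n.-tuple R => \prod_i f i (tnth t i)).
Proof.
move=> mf; apply: measurable_prod => i _.
exact: measurableT_comp (mf i) (measurable_tnth i).
Qed.

(** Induction along the recursive definition of [tuple_lebesgue]: the integral is pulled back along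
    [tcons] to a product measure, where Tonelli splits off the first coordinate. *)
Lemma ge0_integral_tuple_lebesgue_prod n (f : 'I_n -> R -> R) :
  (forall i, measurable_fun setT (f i)) -> (forall i x, 0 <= f i x) ->
  (\int[tuple_lebesgue n]_t (\prod_i f i (tnth t i))%:E =
   \prod_i \int[leb]_x (f i x)%:E)%E.
Proof.
elim: n f => [|n ih] f mf f0.
  under eq_integral do rewrite big_ord0.
  by rewrite big_ord0 integral_dirac//= diracT mul1e.
have mprod := @measurable_prod_tnth n.+1 f mf.
pose g (t : n.-tuple R) := \prod_i f (lift ord0 i) (tnth t i).
have mg : measurable_fun setT g.
  by apply: (measurable_prod_tnth (f := fun i => f (lift ord0 i))) => i.
have g0 t : 0 <= g t by apply: prodr_ge0.
have consE x t : \prod_i f i (tnth (tcons (x, t)) i) = f ord0 x * g t.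
  rewrite big_ord_recl /tcons /=; congr (_ * _).
  by apply: eq_bigr => i _; rewrite tnthS.
have mc : measurable_fun setT (fun z : measurableTypeR R * n.-tuple R =>
    (\prod_i f i (tnth (tcons z) i))%:E).
  apply/measurable_EFinP.
  exact: measurableT_comp mprod (@measurable_tcons _ n).
rewrite (ge0_integral_pushforward (@measurable_tcons _ n)
  (leb \x tuple_lebesgue n)%E)//; last 2 first.
- exact/measurable_EFinP.
- by move=> t _; rewrite lee_fin prodr_ge0.
rewrite preimage_setT fubini_tonelli1//; last first.
  by move=> z; rewrite lee_fin prodr_ge0.
rewrite /fubini_F.
under eq_integral => x _.
  rewrite (_ : integral _ _ _ =
      (f ord0 x)%:E * \int[tuple_lebesgue n]_t (g t)%:E)%E; last first.
    under eq_integral do rewrite /= consE EFinM.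
    rewrite ge0_integralZl//; first exact/measurable_EFinP.
      by move=> t _; rewrite lee_fin.
    by rewrite lee_fin.
  over.
rewrite ge0_integralZr//; last 3 first.
- by apply/measurable_EFinP; exact: mf.
- by move=> x _; rewrite lee_fin.
- by apply: integral_ge0 => t _; rewrite lee_fin.
by rewrite big_ord_recl -ih.
Qed.

Let integrable_prod_setT n (f : 'I_n -> R -> R) :
  (forall i, leb.-integrable setT (EFin \o f i)) ->
  (tuple_lebesgue n).-integrable setT
    (EFin \o (fun t => \prod_i f i (tnth t i))).
Proof.
move=> intf; have mf i : measurable_fun setT (f i).
  by have [/measurable_EFinP] := integrableP _ _ _ (intf i).
apply/integrableP; split.
  by apply/measurable_EFinP; exact: measurable_prod_tnth.
under eq_integral do rewrite /= normr_prod.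
rewrite (@ge0_integral_tuple_lebesgue_prod n (fun i x => `|f i x|))//;
  last first.
  by move=> i; exact: measurableT_comp.
rewrite (eq_bigr (fun i => (\int[leb]_x `|f i x|)%:E)) => [|i _].
  by rewrite prodEFin ltry.
rewrite /Rintegral fineK//.
exact: (integrable_fin_num _ (integrable_norm (intf i))).
Qed.

(** Same induction with Fubini in place of Tonelli; the integrability it requires comes from the
    nonnegative case applied to absolute values. *)
Let Rintegral_prod_setT n (f : 'I_n -> R -> R) :
  (forall i, leb.-integrable setT (EFin \o f i)) ->
  \int[tuple_lebesgue n]_t (\prod_i f i (tnth t i)) =
  \prod_i \int[leb]_x f i x.
Proof.
elim: n f => [|n ih] f intf.
  rewrite /Rintegral; under eq_integral do rewrite big_ord0.
  by rewrite big_ord0 integral_dirac// diracT mul1e.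
have intp := integrable_prod_setT intf.
have mf i : measurable_fun setT (f i).
  by have [/measurable_EFinP] := integrableP _ _ _ (intf i).
have mprod := measurable_prod_tnth mf.
pose g (t : n.-tuple R) := \prod_i f (lift ord0 i) (tnth t i).
have intg : (tuple_lebesgue n).-integrable setT (EFin \o g).
  by apply: (integrable_prod_setT (f := fun i => f (lift ord0 i))) => i.
have consE x t : \prod_i f i (tnth (tcons (x, t)) i) = f ord0 x * g t.
  rewrite big_ord_recl /tcons /=; congr (_ * _).
  by apply: eq_bigr => i _; rewrite tnthS.
pose F (z : measurableTypeR R * n.-tuple R) := (f ord0 z.1 * g z.2)%:E.
have FE : (EFin \o (fun t => \prod_i f i (tnth t i))) \o @tcons R n = F.
  by apply/funext => -[x t] /=; rewrite consE.
have intF : (leb \x tuple_lebesgue n)%E.-integrable setT F.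
  have [_ ioo] := integrableP _ _ _ intp.
  apply/integrableP; split.
    rewrite -FE; apply: measurableT_comp; last exact: measurable_tcons.
    exact/measurable_EFinP.
  apply: le_lt_trans ioo.
  rewrite (ge0_integral_pushforward (@measurable_tcons _ n)
    (leb \x tuple_lebesgue n)%E)//; last first.
    by apply: measurableT_comp => //; exact/measurable_EFinP.
  by rewrite preimage_setT -FE.
rewrite /Rintegral (integral_pushforward (@measurable_tcons _ n)
  (mu := (leb \x tuple_lebesgue n)%E))//; last 2 first.
- exact/measurable_EFinP.
- by rewrite preimage_setT FE.
rewrite preimage_setT FE -integral12_prod_meas1//.
have inner x : (\int[tuple_lebesgue n]_t F (x, t) =
    (f ord0 x)%:E * (\int[tuple_lebesgue n]_t g t)%:E)%E.
  under eq_integral do rewrite /F/= EFinM.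
  by rewrite integralZl// fineK//; exact: integrable_fin_num.
rewrite /fubini_F; under eq_integral do rewrite inner.
rewrite integralZr//; last exact: intf.
rewrite big_ord_recl -ih// -[in RHS]/(g _).
rewrite fineM//; exact: (integrable_fin_num _ (intf ord0)).
Qed.

(* [R] carries two (convertible) measurable structures; [lebesgue_measure] lives
   on the copy [measurableTypeR R]. *)
Let patch_prod n (D : set (measurableTypeR R)) (f : 'I_n -> R -> R) :
  ((fun t : n.-tuple R => \prod_i f i (tnth t i)) \_ (cube n D)) =
  (fun t => \prod_i (f i \_ D) (tnth t i)).
Proof.
apply/funext => t; rewrite patchE; case: ifPn => [/[!inE] Dt|tD].
  by apply: eq_bigr => i _; rewrite patchE mem_set.
have [i Di] : exists i, tnth t i \notin D.
  apply/not_existsP => Dt; case/negP: tD; rewrite inE => i.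
  by have /negP := Dt i; rewrite negbK inE.
by rewrite (bigD1 i)//= patchE (negbTE Di) mul0r.
Qed.

Lemma integrable_tuple_lebesgue_prod n (D : set (measurableTypeR R))
    (f : 'I_n -> R -> R) :
  measurable D -> (forall i, leb.-integrable D (EFin \o f i)) ->
  (tuple_lebesgue n).-integrable (cube n D)
    (EFin \o (fun t => \prod_i f i (tnth t i))).
Proof.
move=> mD intf; apply/integrable_mkcond; first exact: measurable_cube.
rewrite restrict_EFin patch_prod.
apply: (integrable_prod_setT (f := fun i => f i \_ D)) => i.
rewrite -restrict_EFin; exact: (integrable_mkcond _ mD).1.
Qed.

Lemma Rintegral_tuple_lebesgue_prod n (D : set (measurableTypeR R))
    (f : 'I_n -> R -> R) :
  measurable D -> (forall i, leb.-integrable D (EFin \o f i)) ->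
  \int[tuple_lebesgue n]_(t in cube n D) (\prod_i f i (tnth t i)) =
  \prod_i \int[leb]_(x in D) f i x.
Proof.
move=> mD intf; rewrite Rintegral_mkcond patch_prod.
rewrite (Rintegral_prod_setT (f := fun i => f i \_ D)).
  by apply: eq_bigr => i _; rewrite [RHS]Rintegral_mkcond.
move=> i; rewrite -restrict_EFin; exact: (integrable_mkcond _ mD).1.
Qed.

End tuple_lebesgue_product.

(** * Interior points of the moment cone *)

Lemma Rintegral_sum d (T : measurableType d) (R : realType)
    (mu : {measure set T -> \bar R}) (D : set T) (I : Type) (r : seq I)
    (f : I -> T -> R) : measurable D ->
  (forall i, mu.-integrable D (EFin \o f i)) ->
  \int[mu]_(x in D) (\sum_(i <- r) f i x) =
  \sum_(i <- r) \int[mu]_(x in D) f i x.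
Proof.
move=> mD intf; rewrite /Rintegral.
under eq_integral do rewrite -sumEFin.
rewrite (integral_sum mD (f := fun i x => (f i x)%:E))//.
rewrite -sum_fine// => i _; exact: integrable_fin_num (intf i).
Qed.

Section dual_polynomials.
Context {R : realType}.
Local Notation leb := (@lebesgue_measure R).
Local Notation J := (`[1%:R : R, 2%:R : R]%classic).

Lemma measurable_horner (p : {poly R}) : measurable_fun setT (horner p).
Proof. by apply: continuous_measurable_fun; exact: continuous_horner. Qed.

Lemma horner_bound (p : {poly R}) : exists2 K : R, 0 <= K &
  forall x, x \in `[1, 2] -> `|p.[x]| <= K.
Proof.
exists (\sum_(i < size p) `|p`_i| * 2 ^+ i).
  by apply: sumr_ge0 => i _; rewrite mulr_ge0// exprn_ge0.
move=> x; rewrite in_itv/= => /andP[x1 x2].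
have x0 : 0 <= x by exact: le_trans x1.
rewrite horner_coef; apply: (le_trans (ler_norm_sum _ _ _)).
apply: ler_sum => i _; rewrite normrM ler_wpM2l// normrX ger0_norm//.
by rewrite lerXn2r// nnegrE.
Qed.

Lemma integrable_horner (p : {poly R}) : leb.-integrable J (EFin \o horner p).
Proof.
apply: measurable_bounded_integrable => //.
- by rewrite /= lebesgue_measure_itv/= lte_fin ltr1n -EFinB ltry.
- by apply: measurable_funTS; exact: measurable_horner.
- have [K K0 pK] := horner_bound p; exists K; split; first exact: ger0_real.
  by move=> M KM x /= Jx; apply: le_trans (ltW KM); exact: pK.
Qed.

(** If [p] were nonzero, [J] would be covered by a null set and the finitely many roots of [p],
    although it has length 1. This is the definiteness of the Gram matrix of the monomials. *)
Lemma horner_square_integral_eq0 (p : {poly R}) :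
  \int[leb]_(x in J) (p.[x] ^+ 2) = 0 -> p = 0.
Proof.
move=> p0; apply/eqP; apply: contraT => pn0.
have intp : leb.-integrable J (EFin \o (fun x => p.[x] ^+ 2)).
  have -> : (fun x => p.[x] ^+ 2) = horner (p ^+ 2).
    by apply/funext => x; rewrite horner_exp.
  exact: integrable_horner.
have : (\int[leb]_(x in J) `|(p.[x] ^+ 2)%:E| = 0)%E.
  rewrite -(_ : (\int[leb]_(x in J) (p.[x] ^+ 2))%:E = 0%E); last first.
    by rewrite p0.
  rewrite /Rintegral fineK; last exact: integrable_fin_num.
  by apply: eq_integral => x _; rewrite gee0_abs// lee_fin sqr_ge0.
have mp : measurable_fun J (fun x => (p.[x] ^+ 2)%:E) by case/integrableP: intp.
move/(ae_eq_integral_abs leb _ mp) => [|N [mN N0 sub]]; first by [].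
have finroots : finite_set [set x | root p x].
  apply: contrapT => /(infinite_set_fset (size p))[B Bp pB].
  have rB : all (root p) (finmap.enum_fset B) by apply/allP => x; exact: Bp.
  by have := max_poly_roots pn0 rB (finmap.fset_uniq B); rewrite ltnNge pB.
have JN : J `<=` N `|` [set x | root p x].
  move=> x Jx; have [rx|rx] := boolP (root p x); [by right|left].
  apply: sub => /= /(_ Jx) [] /eqP; rewrite expf_eq0 /= => px.
  by move/negP: rx; rewrite rootE.
have : (leb J <= 0)%E.
  have mroots : measurable ([set x | root p x] : set (measurableTypeR R)).
    exact/countable_measurable/finite_set_countable.
  apply: (@le_trans _ _ (leb (N `|` [set x | root p x]))).
    by apply: le_measure => //; rewrite inE//; exact: measurableU.
  apply: le_trans (measureU2 _ mN mroots) _.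
  rewrite /= N0 add0e countable_lebesgue_measure0//.
  exact: finite_set_countable.
rewrite /= lebesgue_measure_itv/= lte_fin ltr1n -EFinB lee_fin.
lra.
Qed.

(** The coefficients of the dual basis are the rows of the inverse of the Gram matrix [G] of the
    monomials on [[1, 2]]. *)
Lemma dual_polynomials d : exists p : 'I_d.+1 -> {poly R},
  forall a b : 'I_d.+1,
    \int[leb]_(x in J) (x ^+ a * (p b).[x]) = (a == b)%:R.
Proof.
pose P (v : 'rV[R]_d.+1) : {poly R} := \poly_(i < d.+1) v 0 (inord i).
pose G : 'M[R]_d.+1 := \matrix_(a, b) \int[leb]_(x in J) (x ^+ a * x ^+ b).
have PE v x : (P v).[x] = \sum_(i < d.+1) v 0 i * x ^+ i.
  by rewrite horner_poly; apply: eq_bigr => i _; rewrite inord_val.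
have intE (f : R -> R) (p : {poly R}) : (forall x, f x = p.[x]) ->
    leb.-integrable J (EFin \o f).
  by move=> /funext ->; exact: integrable_horner.
have lin v b : (v *m G) 0 b = \int[leb]_(x in J) (x ^+ b * (P v).[x]).
  under eq_Rintegral do rewrite PE mulr_sumr.
  rewrite (Rintegral_sum _ (f := fun (i : 'I_d.+1) (x : measurableTypeR R) =>
    (x : R) ^+ b * (v 0 i * x ^+ i)))//.
    rewrite mxE; apply: eq_bigr => i _; rewrite mxE -RintegralZl//.
      by apply: eq_Rintegral => x _; ring.
    by apply: (intE _ ('X^i * 'X^b)) => x; rewrite !hornerE ?hornerXn.
  move=> i; apply: (intE _ ('X^b * (v 0 i *: 'X^i))) => x.
  by rewrite !hornerE ?hornerXn.
have uG : G \in unitmx.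
  rewrite -row_free_unit; apply: inj_row_free => v vG.
  (* The integral of [P v ^+ 2] is the quadratic form of [G] at [v], which vanishes since
     [v *m G = 0]. *)
  have Pv0 : P v = 0.
    apply: horner_square_integral_eq0.
    under eq_Rintegral do rewrite expr2 {1}PE mulr_suml.
    rewrite (Rintegral_sum _ (f := fun (i : 'I_d.+1) (x : measurableTypeR R) =>
      v 0 i * x ^+ i * (P v).[x]))//.
      rewrite big1// => i _; under eq_Rintegral do rewrite -mulrA.
      rewrite RintegralZl// -?lin ?vG ?mxE ?mulr0//.
      by apply: (intE _ ('X^i * P v)) => x; rewrite !hornerE ?hornerXn.
    move=> i; apply: (intE _ (v 0 i *: 'X^i * P v)) => x.
    by rewrite !hornerE ?hornerXn.
  apply/rowP => i; rewrite mxE.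
  have := congr1 (fun p : {poly R} => p`_i) Pv0.
  by rewrite coef0 coef_poly ltn_ord inord_val.
exists (fun b => P (row b (invmx G))) => a b.
by rewrite -lin -row_mul mulVmx// !mxE eq_sym.
Qed.

End dual_polynomials.

(** Lets products of one-dimensional dual polynomials be dual to the multivariate monomials. *)
Lemma multiindex_eqE (R : comNzRingType) n d (alpha beta : multiindex n d) :
  (alpha == beta)%:R = \prod_i (val alpha i == val beta i)%:R :> R.
Proof.
have [<-|ab] := eqVneq alpha beta; first by rewrite big1// => i _; rewrite eqxx.
have [i abi] : exists i, val alpha i != val beta i.
  apply/existsP; rewrite -negb_forall; apply: contra ab => /forallP abi.
  by apply/eqP/val_inj/ffunP => i; exact/eqP.
by rewrite (bigD1 i)//= (negbTE abi) mul0r.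
Qed.

Section moment_cone_interior.
Context {R : realType} (n d : nat).
Local Notation leb := (@lebesgue_measure R).
Local Notation J := (`[1%:R : R, 2%:R : R]%classic).
Local Notation I := (multiindex n d).

Lemma measurable_monomial (alpha : I) :
  measurable_fun setT (@monomial R n d alpha).
Proof.
apply: (measurable_prod_tnth (f := fun i x => x ^+ val alpha i)) => i.
exact: exprn_measurable.
Qed.

Lemma moment_cone_interior (X : set (n.-tuple R)) (f : n.-tuple R -> R)
    (mX : measurable X) (mf : measurable_fun X f)
    (f0 : forall x, X x -> 0 <= f x) (g0 : R) :
  0 < g0 -> cube n J `<=` X -> (forall x, cube n J x -> g0 <= f x) ->
  (forall alpha : I, (tuple_lebesgue n).-integrable X
     (EFin \o (fun x => monomial alpha x * f x))) ->
  exists2 theta : R, 0 < theta & forall s : I -> R,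
    (forall alpha,
      `|s alpha - \int[mdensity (tuple_lebesgue n) mX mf f0]_(x in X)
         monomial alpha x| <= theta) ->
    moment_cone X (@monomial R n d) s.
Proof.
(* On the cube [1, 2]^n the density is perturbed by the combination [q] of
   products of polynomials dual to the monomials, which moves the moment vector
   by exactly [delta]. *)
move=> g0_gt0 JX fg0 intf; set B := cube n J in JX fg0.
have mJ : measurable (J : set (measurableTypeR R)) by [].
have mB : measurable B by exact: measurable_cube.
have [p pdual] := dual_polynomials d (R := R).
have /choice[K Kp] (b : 'I_d.+1) : exists K : R, 0 <= K /\
    forall x, x \in `[1, 2] -> `|(p b).[x]| <= K.
  by have [K ? ?] := horner_bound (p b); exists K.
pose P (beta : I) (x : n.-tuple R) := \prod_i (p (val beta i)).[tnth x i].
(* One bound for all [P beta] on the cube: each of the [n] factors is at most the sum of all the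
   [K b]. *)
pose C := (\sum_b K b) ^+ n.
have PC beta x : B x -> `|P beta x| <= C.
  move=> Bx; rewrite /P normr_prod /C -[n in X in _ <= X]card_ord -prodr_const.
  apply: ler_prod => i _; rewrite normr_ge0/=.
  apply: (le_trans ((Kp (val beta i)).2 _ (Bx i))).
  by rewrite (bigD1 (val beta i))//= lerDl sumr_ge0// => b _; exact: (Kp b).1.
have C0 : 0 <= C by rewrite exprn_ge0// sumr_ge0// => b _; exact: (Kp b).1.
have den0 : 0 < #|{: I}|%:R * C + 1 by rewrite ltr_wpDl// mulr_ge0.
(* This radius bounds the perturbation [q] by [g0] on the cube, so the perturbed density stays
   nonnegative; the [+ 1] keeps the denominator positive. *)
exists (g0 / (#|{: I}|%:R * C + 1)); first by rewrite divr_gt0.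
pose t (alpha : I) := \int[mdensity (tuple_lebesgue n) mX mf f0]_(x in X)
  monomial alpha x.
move=> s st; pose delta beta := s beta - t beta.
pose q x := \sum_beta delta beta * P beta x.
have qg0 x : B x -> `|q x| <= g0.
  move=> Bx.
  apply: (@le_trans _ _ (\sum_(beta : I) g0 / (#|{: I}|%:R * C + 1) * C)).
    apply: (le_trans (ler_norm_sum _ _ _)); apply: ler_sum => beta _.
    by rewrite normrM ler_pM// ?PC// st.
  rewrite sumr_const -[leLHS]mulr_natr -mulrA mulrAC ler_pdivrMr//.
  rewrite ler_wpM2l ?ltW//.
  by lra.
have mP beta : measurable_fun setT (P beta).
  by apply: (measurable_prod_tnth (f := fun i => horner (p (val beta i)))) => i;
    exact: measurable_horner.
have mq : measurable_fun setT q.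
  by apply: measurable_sum => beta; exact: measurable_funM.
have mqB : measurable_fun setT (q \_ B).
  by apply/(measurable_restrictT _ mB)/measurable_funTS.
pose F x := f x + (q \_ B) x.
have mF : measurable_fun X F.
  by apply: measurable_funD => //; exact: measurable_funTS.
have F0 x : X x -> 0 <= F x.
  move=> Xx; rewrite /F patchE; case: ifPn => [/[!inE] Bx|_]; last first.
    by rewrite addr0 f0.
  rewrite -lerBlDr sub0r; apply: le_trans (fg0 _ Bx).
  by apply: le_trans (qg0 _ Bx); rewrite lerNl lerNnormlW.
pose w (alpha beta : I) (i : 'I_n) :=
  horner ('X^(val alpha i) * p (val beta i)).
have wE alpha beta x :
    monomial alpha x * P beta x = \prod_i w alpha beta i (tnth x i).
  by rewrite -big_split; apply: eq_bigr => i _; rewrite /w hornerM hornerXn.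
have intw alpha beta : (tuple_lebesgue n).-integrable B
    (EFin \o (fun x => \prod_i w alpha beta i (tnth x i))).
  by apply: integrable_tuple_lebesgue_prod => // i; exact: integrable_horner.
have intwE alpha beta : \int[tuple_lebesgue n]_(x in B)
    (\prod_i w alpha beta i (tnth x i)) = (alpha == beta)%:R.
  rewrite Rintegral_tuple_lebesgue_prod//; last first.
    by move=> i; exact: integrable_horner.
  under eq_bigr => i _.
    under eq_Rintegral do rewrite /w hornerM hornerXn.
    rewrite pdual; over.
  by rewrite multiindex_eqE.
pose r (alpha : I) x :=
  \sum_beta delta beta * \prod_i w alpha beta i (tnth x i).
have monF alpha x : monomial alpha x * F x =
    monomial alpha x * f x + (r alpha \_ B) x.
  rewrite /F mulrDr !patchE; case: ifPn => _; last by rewrite mulr0.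
  congr (_ + _); rewrite mulr_sumr; apply: eq_bigr => beta _.
  by rewrite mulrCA wE.
have intdw alpha beta : (tuple_lebesgue n).-integrable B
    (EFin \o (fun x => delta beta * \prod_i w alpha beta i (tnth x i))).
  exact: (integrableZl _ (delta beta) (intw alpha beta)).
have intr alpha : (tuple_lebesgue n).-integrable B (EFin \o r alpha).
  apply: (eq_integrable mB (fun x => \sum_(beta <- index_enum I)
      (delta beta * \prod_i w alpha beta i (tnth x i))%:E)%E).
    by move=> x _; rewrite sumEFin.
  by apply: integrable_sum => // beta _; exact: intdw.
have XB : X `&` B = B by exact: setIidr.
have intrB alpha : (tuple_lebesgue n).-integrable X (EFin \o (r alpha \_ B)).
  by rewrite -restrict_EFin; apply/integrable_restrict => //; rewrite XB.
have intF (alpha : I) : (tuple_lebesgue n).-integrable X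
    (EFin \o (fun x => monomial alpha x * F x)).
  have := integrableD mX (intf alpha) (intrB alpha).
  by apply: eq_integrable => // x _; rewrite /= monF.
have mmon (alpha : I) : measurable_fun X (@monomial R n d alpha).
  by apply: measurable_funTS; exact: measurable_monomial.
exists (mdensity (tuple_lebesgue n) mX mF F0); split => alpha.
  exact: integrable_mdensity.
rewrite Rintegral_mdensity//; under eq_Rintegral do rewrite monF.
rewrite RintegralD// -Rintegral_mdensity// -/(t alpha).
rewrite -Rintegral_mkcondr XB /r Rintegral_sum//.
rewrite (bigD1 alpha)//= RintegralZl// intwE eqxx mulr1 big1 ?addr0.
  by rewrite /delta addrC subrK.
by move=> beta /negbTE ab; rewrite RintegralZl// intwE eq_sym ab mulr0.
Qed.

End moment_cone_interior.

(** * One-dimensional Gaussian and log-normal moments *)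

Section exp_substitution.
Context {R : realType}.
Local Notation leb := (@lebesgue_measure R).

Let bigcup_itv_nat : \bigcup_(i : nat) `[- (i%:R : R), i%:R]%classic = setT.
Proof.
apply/seteqP; split => // x _.
exists (Num.truncn `|x|).+1 => //=; rewrite in_itv/= -ler_norml.
exact/ltW/truncnS_gt.
Qed.

Let bigcup_itv_expR :
  \bigcup_(i : nat) `[expR (- i%:R), expR (i%:R : R)]%classic =
  `]0, +oo[%classic.
Proof.
apply/seteqP; split => [x [i _]|x] /=; rewrite !in_itv/= ?andbT.
  by case/andP => + _; exact/lt_le_trans/expR_gt0.
move=> x0; have : (\bigcup_(i : nat) `[- (i%:R : R), i%:R]%classic) (ln x).
  by rewrite bigcup_itv_nat.
case=> i _ /=; rewrite !in_itv/= => /andP[lx xl]; exists i => //=.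
by rewrite in_itv/= -[x in _ <= x <= _]lnK ?posrE// !ler_expR lx.
Qed.

(* The substitution lemmas of the library for unbounded intervals require the
   derivative to converge at infinity, which fails for [expR]: the half line is
   exhausted by compact intervals instead. *)
Lemma ge0_integral_expR_substitution (G : R -> R) :
  {in `]0, +oo[, continuous G} -> (forall x, 0 < x -> 0 <= G x) ->
  (\int[leb]_(x in `]0%R, +oo[) (G x)%:E =
   \int[leb]_x (G (expR x) * expR x)%:E)%E.
Proof.
move=> cG G0.
have cGe : continuous (fun x => G (expR x) * expR x).
  move=> x; apply: cvgM; last exact: continuous_expR.
  apply: (@continuous_comp _ _ _ expR G); first exact: continuous_expR.
  by apply: cG; rewrite in_itv/= expR_gt0.
rewrite -bigcup_itv_expR -bigcup_itv_nat.
have nd (u v : nat -> R) :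
    (forall i, u i.+1 <= u i) -> (forall i, v i <= v i.+1) ->
    nondecreasing_seq (fun i => `[u i, v i]%classic : set (measurableTypeR R)).
  move=> uS vS; apply/nondecreasing_seqP => i; rewrite subsetEset => x /=.
  by rewrite !in_itv/= => /andP[ux xv]; rewrite (le_trans _ ux)// (le_trans xv).
have sG i : `[expR (- i%:R), expR (i%:R : R)] `<=` `]0, +oo[.
  by rewrite -bigcup_itv_expR => x; exists i.
have wG i : {within `[expR (- i%:R), expR (i%:R : R)], continuous G}.
  apply: continuous_in_subspaceT => x; rewrite inE => /sG; exact: cG.
have iS (i : nat) : (i%:R : R) <= i.+1%:R by rewrite ler_nat.
pose A i : set (measurableTypeR R) := `[- (i%:R : R), i%:R]%classic.
pose B i : set (measurableTypeR R) := `[expR (- i%:R), expR (i%:R : R)]%classic.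
have AB i : (\int[leb]_(x in B i) (G x)%:E =
    \int[leb]_(x in A i) (G (expR x) * expR x)%:E)%E.
  have dE : (@expR R)^`()%classic = expR.
    by apply/funext => x; rewrite derive1E; exact: derive_val.
  rewrite (integration_by_substitution_increasing (F := @expR R)
    _ _ _ _ _ _ (wG i)).
  - by apply: eq_integral => x _; rewrite dE.
  - by rewrite (@le_trans _ _ 0)// oppr_le0.
  - by move=> x y _ _; rewrite ltr_expR.
  - by move=> x _; rewrite dE; exact: continuous_expR.
  - rewrite dE; apply/cvg_ex; exists (expR (- i%:R)).
    by apply: cvg_at_right_filter; exact: continuous_expR.
  - rewrite dE; apply/cvg_ex; exists (expR i%:R).
    by apply: cvg_at_left_filter; exact: continuous_expR.
  - split=> [x _||]; first exact: derivable_expR.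
      by apply: cvg_at_right_filter; exact: continuous_expR.
    by apply: cvg_at_left_filter; exact: continuous_expR.
have h1 := @ge0_nondecreasing_set_cvg_integral _ _ _ B (EFin \o G) leb.
have h2 := @ge0_nondecreasing_set_cvg_integral _ _ _ A
  (fun x => (G (expR x) * expR x)%:E) leb.
apply: cvg_unique (h1 _ _ _ _) _ => //.
- by apply: nd => i; rewrite ler_expR ?lerN2.
- by move=> i; exact: measurable_itv.
- by move=> i; apply/measurable_EFinP;
    apply: subspace_continuous_measurable_fun (wG i); exact: measurable_itv.
- by move=> i x /sG/=; rewrite in_itv/= andbT lee_fin; exact: G0.
rewrite (_ : (fun i => _) =
    (fun i => integral leb (A i) (fun x => (G (expR x) * expR x)%:E))).
  apply: h2 => //.
  - by apply: nd => i; rewrite ?lerN2.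
  - by move=> i; exact: measurable_itv.
  - move=> i; apply/measurable_EFinP; apply: measurable_funTS.
    exact: continuous_measurable_fun.
  - by move=> i x _; rewrite lee_fin mulr_ge0 ?expR_ge0// G0// expR_gt0.
by apply/funext => i; exact: AB.
Qed.

End exp_substitution.

Section normal_moments.
Context {R : realType}.
Local Notation leb := (@lebesgue_measure R).
Implicit Types (m s b x : R) (k : nat).

(** Completing the square in the exponent. It serves both the exponential moments, which are the
    log-normal ones, and the integrability of powers. *)
Lemma normal_pdf_tilt m s b x : s != 0 ->
  expR (b * x) * normal_pdf m s x =
  expR (b * m + b ^+ 2 * s ^+ 2 / 2) * normal_pdf (m + b * s ^+ 2) s x.
Proof.
move=> s0; rewrite !normal_pdfE// ![_ * (normal_peak _ * _)]mulrCA.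
congr (_ * _).
rewrite /normal_fun -!expRD; congr expR; field; exact: s0.
Qed.

Lemma integrable_expR_normal_pdf m s b : s != 0 ->
  leb.-integrable setT (EFin \o (fun x => expR (b * x) * normal_pdf m s x)).
Proof.
move=> s0; under eq_fun do rewrite normal_pdf_tilt//.
exact: (integrableZl _ _ (integrable_normal_pdf _ _)).
Qed.

Lemma Rintegral_expR_normal_pdf m s b : s != 0 ->
  \int[leb]_x (expR (b * x) * normal_pdf m s x) =
  expR (b * m + b ^+ 2 * s ^+ 2 / 2).
Proof.
move=> s0; under eq_Rintegral do rewrite normal_pdf_tilt//.
rewrite RintegralZl//; last exact: integrable_normal_pdf.
by rewrite /Rintegral integral_normal_pdf mulr1.
Qed.

(** Domination by exponentials: [|x| ^+ k <= expR (k * |x|)], and the latter is at most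
    [expR (k * x) + expR (- k * x)]. *)
Lemma integrable_exprn_normal_pdf m s k : s != 0 ->
  leb.-integrable setT (EFin \o (fun x => x ^+ k * normal_pdf m s x)).
Proof.
move=> s0; have mX : measurable_fun setT (fun x => x ^+ k * normal_pdf m s x).
  apply: measurable_funM; first exact: exprn_measurable.
  exact: measurable_normal_pdf.
have hp := integrable_expR_normal_pdf m k%:R s0.
have hn := integrable_expR_normal_pdf m (- k%:R) s0.
apply: le_integrable (integrableD measurableT hp hn) => //.
  exact/measurable_EFinP.
move=> x _; rewrite /= -mulrDl lee_fin !normrM ler_wpM2r//.
rewrite [leRHS]ger0_norm ?addr_ge0 ?expR_ge0// normrX.
have : `|x| ^+ k <= expR (k%:R * `|x|).
  rewrite expRM_natl lerXn2r ?nnegrE ?expR_ge0//.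
  by apply: le_trans (expR_ge1Dx _); rewrite lerDr.
move/le_trans; apply; have [x0|x0] := ger0P x; first by rewrite lerDl expR_ge0.
by rewrite mulrN -mulNr lerDr expR_ge0.
Qed.

(** Standardisation by the increasing substitution [F x = m + s * x], whose derivative [s] turns the
    density into the standard one. *)
Let integral_normal_affine (G : R -> R) m s : 0 < s -> continuous G ->
  (forall x, 0 <= G x) ->
  (\int[leb]_x (G x * normal_pdf m s x)%:E =
   \int[leb]_x (G (m + s * x) * normal_pdf 0 1 x)%:E)%E.
Proof.
move=> s0 cG G0; have sn0 : s != 0 by rewrite gt_eqF.
pose F x := m + s * x.
have F' : F^`()%classic = cst s.
  apply/funext => x; rewrite derive1E /F deriveD// derive_cst add0r deriveM//.
  by rewrite derive_id derive_cst scaler0 addr0 /GRing.scale/= mulr1.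
have pdfE x : normal_pdf m s (F x) * s = normal_pdf 0 1 x.
  rewrite !normal_pdfE ?oner_eq0// mulrAC; congr (_ * _).
    rewrite /normal_peak.
    have -> : s ^+ 2 * pi *+ 2 = s ^+ 2 * (1 ^+ 2 * pi *+ 2).
      by rewrite expr1n mul1r mulrnAr.
    rewrite sqrtrM ?sqr_ge0// sqrtr_sqr gtr0_norm// invfM mulrC mulrA divff//.
    by rewrite mul1r.
  by rewrite /normal_fun /F; congr expR; field; exact: sn0.
rewrite (@increasing_ge0_integration_by_substitutionT _ F).
- by apply: eq_integral => x _; rewrite F' -pdfE mulrA.
- by move=> x y xy; rewrite /F ltrD2l ltr_pM2l.
- by rewrite F' => x; exact: cvg_cst.
- by rewrite F'; exact: is_cvg_cst.
- by rewrite F'; exact: is_cvg_cst.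
- by move=> x; apply: derivableD.
- apply: (cvg_comp _ _ _ (cvg_addrl_Ny m)).
  by apply: gt0_cvgMrNy => //; exact: cvg_id.
- apply: (cvg_comp _ _ _ (cvg_addrl m)).
  by apply: gt0_cvgMry => //; exact: cvg_id.
- move=> x; apply: cvgM; [exact: cG|exact: continuous_normal_pdf].
- by move=> x; rewrite mulr_ge0// normal_pdf_ge0.
Qed.

Let Rintegral_normal_affine (G : R -> R) m s : 0 < s -> continuous G ->
  leb.-integrable setT (EFin \o (fun x => G x * normal_pdf m s x)) ->
  leb.-integrable setT (EFin \o (fun x => G (m + s * x) * normal_pdf 0 1 x)) ->
  \int[leb]_x (G x * normal_pdf m s x) =
  \int[leb]_x (G (m + s * x) * normal_pdf 0 1 x).
Proof.
move=> s0 cG iG iGa.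
have cN : continuous (fun x => `|G x|).
  by move=> x; apply: cvg_norm; exact: cG.
have normE (H : R -> R) m' s' : leb.-integrable setT
    (EFin \o (fun x => H x * normal_pdf m' s' x)) ->
    leb.-integrable setT (EFin \o (fun x => `|H x| * normal_pdf m' s' x)).
  move=> /integrable_norm; apply: eq_integrable => // x _ /=.
  by rewrite normrM (ger0_norm (normal_pdf_ge0 _ _ _)).
have iN := normE _ _ _ iG.
have iNa := normE (fun x => G (m + s * x)) _ _ iGa.
(* Splitting [H = (|H| + H) - |H|] reduces the claim to nonnegative functions. *)
have split (H : R -> R) m' s' : leb.-integrable setT
    (EFin \o (fun x => H x * normal_pdf m' s' x)) ->
    \int[leb]_x (H x * normal_pdf m' s' x) =
    \int[leb]_x ((`|H x| + H x) * normal_pdf m' s' x) -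
    \int[leb]_x (`|H x| * normal_pdf m' s' x).
  move=> iH; have iNH := normE _ _ _ iH.
  rewrite -RintegralB//; first by apply: eq_Rintegral => x _; lra.
  have := integrableD measurableT iNH iH.
  by apply: eq_integrable => // x _ /=; rewrite mulrDl.
have eN := integral_normal_affine m s0 cN (fun x => normr_ge0 (G x)).
have cS : continuous (fun x => `|G x| + G x).
  by move=> x; apply: cvgD; [exact: cN|exact: cG].
have S0 x : 0 <= `|G x| + G x by rewrite -lerBlDr sub0r lerNl lerNnormlW.
have eS := integral_normal_affine m s0 cS S0.
rewrite (split _ _ _ iG) (split (fun x => G (m + s * x)) _ _ iGa).
by rewrite /Rintegral eN eS.
Qed.

(** Binomial expansion of [(m + s * x) ^+ k] under the standard normal law. The point is that the
    result is a polynomial in [m] whose coefficients do not involve [m]. *)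
Lemma Rintegral_exprn_normal_pdf m s k : 0 < s ->
  \int[leb]_x (x ^+ k * normal_pdf m s x) =
  \sum_(b < k.+1) 'C(k, b)%:R * s ^+ (k - b) *
    \int[leb]_x (x ^+ (k - b) * normal_pdf 0 1 x) * m ^+ b.
Proof.
move=> s0; have iX j : leb.-integrable setT
    (EFin \o (fun x => x ^+ j * normal_pdf 0 1 x)).
  by apply: integrable_exprn_normal_pdf; exact: oner_neq0.
have expand x : (m + s * x) ^+ k * normal_pdf 0 1 x =
    \sum_(b < k.+1) ('C(k, b)%:R * s ^+ (k - b) * m ^+ b) *
      (x ^+ (k - b) * normal_pdf 0 1 x).
  rewrite addrC exprDn mulr_suml; apply: eq_bigr => b _.
  by rewrite exprMn -mulr_natr; ring.
have iT (b : 'I_k.+1) : leb.-integrable setT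
    (EFin \o (fun x => ('C(k, b)%:R * s ^+ (k - b) * m ^+ b) *
      (x ^+ (k - b) * normal_pdf 0 1 x))).
  exact: (integrableZl measurableT _ (iX (k - b)%N)).
rewrite (Rintegral_normal_affine (G := fun x => x ^+ k))//.
- under eq_Rintegral do rewrite expand.
  rewrite Rintegral_sum//; apply: eq_bigr => b _.
  by rewrite RintegralZl//; ring.
- exact: exprn_continuous.
- by apply: integrable_exprn_normal_pdf; rewrite gt_eqF.
- have iS : leb.-integrable setT (fun x : measurableTypeR R =>
      (\sum_(b < k.+1) (('C(k, b)%:R * s ^+ (k - b) * m ^+ b) *
        ((x : R) ^+ (k - b) * normal_pdf 0 1 x))%:E)%E).
    by apply: integrable_sum => // b _; exact: iT.
  by apply: eq_integrable iS => // x _; rewrite /= expand sumEFin.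
Qed.

Let continuous_lognormal m s k : s != 0 ->
  {in `]0, +oo[, continuous (fun x => x ^+ k * (normal_pdf m s (ln x) / x))}.
Proof.
move=> s0 x; rewrite in_itv/= andbT => x0.
apply: cvgM; first exact: exprn_continuous.
apply: cvgM; last by apply: cvgV; [rewrite gt_eqF|exact: cvg_id].
apply: (@continuous_comp _ _ _ (@ln R) (normal_pdf m s)).
  exact: continuous_ln.
exact: continuous_normal_pdf.
Qed.

(** Under [x = expR y] the factor [1 / x] cancels the Jacobian and [x ^+ k] becomes [expR (k * y)],
    leaving an exponential moment of a normal law. *)
Let integral_lognormal m s k : s != 0 ->
  (\int[leb]_(x in `]0%R, +oo[) (x ^+ k * (normal_pdf m s (ln x) / x))%:E =
   (expR (k%:R * m + k%:R ^+ 2 * s ^+ 2 / 2))%:E)%E.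
Proof.
move=> s0; rewrite (ge0_integral_expR_substitution
  (G := fun x => x ^+ k * (normal_pdf m s (ln x) / x))); last 2 first.
- exact: continuous_lognormal.
- by move=> x x0; rewrite mulr_ge0 ?exprn_ge0 ?divr_ge0 ?normal_pdf_ge0 ?ltW.
rewrite -Rintegral_expR_normal_pdf// /Rintegral fineK; last first.
  by apply: integrable_fin_num => //; exact: integrable_expR_normal_pdf.
apply: eq_integral => x _; congr EFin.
by rewrite expRK -mulrA divfK ?expRM_natl// gt_eqF// expR_gt0.
Qed.

Lemma integrable_exprn_lognormal_pdf m s k : s != 0 ->
  leb.-integrable `]0, +oo[
    (EFin \o (fun x => x ^+ k * (normal_pdf m s (ln x) / x))).
Proof.
move=> s0; apply/integrableP; split.
  apply/measurable_EFinP; apply: open_continuous_measurable_fun => //.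
  by move=> x; rewrite inE/= => x0; exact: continuous_lognormal.
under eq_integral => x.
  rewrite inE/= in_itv/= andbT => x0; rewrite ger0_norm; last first.
    by rewrite mulr_ge0 ?exprn_ge0 ?divr_ge0 ?normal_pdf_ge0 ?ltW.
  over.
by rewrite integral_lognormal// ltry.
Qed.

Lemma Rintegral_exprn_lognormal_pdf m s k : s != 0 ->
  \int[leb]_(x in `]0, +oo[) (x ^+ k * (normal_pdf m s (ln x) / x)) =
  expR (k%:R * m + k%:R ^+ 2 * s ^+ 2 / 2).
Proof. by move=> s0; rewrite /Rintegral integral_lognormal. Qed.

End normal_moments.

(** * Gaussian and log-normal mixtures *)

Section quadform_bounds.
Context {R : realType} {n : nat}.
Implicit Types (sigma : 'M[R]_n) (v : 'cV[R]_n).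

(** By symmetry, the square of [invmx sigma] is its transpose times itself. *)
Lemma quadform_sum_sqr sigma v : sigma^T = sigma ->
  quadform sigma v = \sum_i (invmx sigma *m v) i 0 ^+ 2.
Proof.
move=> symm; have symV : (invmx sigma)^T = invmx sigma by rewrite trmx_inv symm.
rewrite /quadform mulmxA -mulmxA -{1}symV -trmx_mul mxE.
by apply: eq_bigr => i _; rewrite mxE expr2.
Qed.

(** Write [v = sigma *m u]. Each coordinate of [v] is at most the l1 norm of a row of [sigma] times
    the Euclidean norm of [u]; squaring and summing gives the constant [S]. *)
Lemma quadform_coercive sigma : symmetric_nonsingular sigma ->
  exists2 c : R, 0 < c & forall v, c * (\sum_i v i 0 ^+ 2) <= quadform sigma v.
Proof.
move=> [symm usigma]; pose S := \sum_i (\sum_j `|sigma i j|) ^+ 2.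
have S0 : 0 <= S by apply: sumr_ge0 => i _; exact: sqr_ge0.
exists (S + 1)^-1; first by rewrite invr_gt0 ltr_wpDl.
move=> v; rewrite mulrC ler_pdivrMr ?ltr_wpDl// quadform_sum_sqr//.
set u := invmx sigma *m v; set U := \sum_i u i 0 ^+ 2.
have U0 : 0 <= U by apply: sumr_ge0 => i _; exact: sqr_ge0.
apply: (@le_trans _ _ (U * S)); last by rewrite ler_wpM2l// lerDl.
have uU j : `|u j 0| <= Num.sqrt U.
  rewrite -sqrtr_sqr ler_sqrt// /U (bigD1 j)//= lerDl sumr_ge0// => i _.
  exact: sqr_ge0.
rewrite mulr_sumr; apply: ler_sum => i _.
have -> : v i 0 = \sum_j sigma i j * u j 0.
  by rewrite -[v](mulKVmx usigma) mxE.
rewrite -real_normK ?num_real// -(sqr_sqrtr U0) -exprMn mulrC.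
rewrite lerXn2r ?nnegrE ?mulr_ge0 ?sqrtr_ge0 ?sumr_ge0// mulr_suml.
apply: (le_trans (ler_norm_sum _ _ _)); apply: ler_sum => j _.
by rewrite normrM ler_wpM2l.
Qed.

Lemma quadform_bounded sigma (V : R) : exists Q : R, forall v,
  (forall i, `|v i 0| <= V) -> quadform sigma v <= Q.
Proof.
pose P := invmx sigma *m invmx sigma.
exists (\sum_j (\sum_i V * `|P i j|) * V) => v vV.
rewrite quadformE; apply: ler_sum => j _; rewrite !mulr_suml.
apply: ler_sum => i _; apply: le_trans (ler_norm _) _; rewrite !normrM.
by rewrite ler_pM// ?ler_wpM2r// mulr_ge0.
Qed.

Lemma quadform_scalar (e : R) v : e != 0 ->
  quadform (e%:M) v = e ^- 2 * \sum_i v i 0 ^+ 2.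
Proof.
move=> e0; rewrite quadform_sum_sqr ?tr_scalar_mx// mulr_sumr.
apply: eq_bigr => i _; rewrite invmx_scalar mul_scalar_mx mxE exprMn exprVn.
by [].
Qed.

Lemma symmetric_nonsingular_scalar (e : R) : e != 0 ->
  symmetric_nonsingular (e%:M : 'M[R]_n).
Proof.
move=> e0; split; first by rewrite tr_scalar_mx.
by rewrite unitmxE det_scalar unitrX// unitfE.
Qed.

End quadform_bounds.

Lemma near_prod (R : realFieldType) n (a b : 'I_n -> R) (eta : R) :
  0 <= eta <= 1 -> (forall i, `|b i| <= 1) -> (forall i, `|a i - b i| <= eta) ->
  `|\prod_i a i - \prod_i b i| <= 2 ^+ n * eta.
Proof.
move=> /andP[eta0 eta1] b1 ab.
(* The sharper constant closes the induction: one more factor, bounded by 2, turns [2 ^+ n - 1] into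
   [2 * (2 ^+ n - 1) + 1]. *)
suff : `|\prod_i a i - \prod_i b i| <= (2 ^+ n - 1) * eta.
  by move/le_trans; apply; rewrite ler_wpM2r// gerBl.
elim: n a b b1 ab => [|n ih] a b b1 ab.
  by rewrite !big_ord0 !subrr normr0 mul0r.
rewrite !big_ord_recl; set A := \prod_(i < n) _; set B := \prod_(i < n) _.
have AB : `|A - B| <= (2 ^+ n - 1) * eta by exact: ih.
have B1 : `|B| <= 1.
  by rewrite normr_prod prodr_ile1// => i _; rewrite normr_ge0 b1.
have a2 : `|a ord0| <= 2.
  have := ler_normD (a ord0 - b ord0) (b ord0); rewrite subrK.
  by have := ab ord0; have := b1 ord0; lra.
have -> : a ord0 * A - b ord0 * B =
    a ord0 * (A - B) + (a ord0 - b ord0) * B by ring.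
apply: le_trans (ler_normD _ _) _; rewrite !normrM.
have h1 : `|a ord0| * `|A - B| <= 2 * ((2 ^+ n - 1) * eta) by rewrite ler_pM.
have h2 : `|a ord0 - b ord0| * `|B| <= eta * 1 by rewrite ler_pM.
rewrite exprS; lra.
Qed.

(* Gaussian measures are the case [D = setT], [l = id], [w = 1], log-normal ones
   the case [D = ]0, +oo[], [l = ln], [w = id]. *)
Section charts.
Context {R : realType} (n d : nat).
Local Notation leb := (@lebesgue_measure R).
Local Notation J := (`[1%:R : R, 2%:R : R]%classic).
Local Notation I := (multiindex n d).
Local Notation tl := (@tuple_lebesgue R n).

Variables (D : set (measurableTypeR R)) (l w : R -> R).
Hypotheses (mD : measurable D) (JD : J `<=` D).
Hypotheses (w0 : forall x : R, D x -> 0 < w x)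
  (lJ : forall x, J x -> `|l x| <= 2) (wJ : forall x, J x -> w x <= 2).
Hypothesis int1 : forall m s k, s != 0 ->
  leb.-integrable D (EFin \o (fun x => x ^+ k * (normal_pdf m s (l x) / w x))).

Variables (X : set (n.-tuple R)) (mX : measurable X).
Hypothesis XE : X = cube n D.
Variable pdf : n.-tuple R -> 'M[R]_n -> n.-tuple R -> R.
Hypotheses (mpdf : forall xi sigma, measurable_fun X (pdf xi sigma))
  (pdf0 : forall xi sigma x, X x -> 0 <= pdf xi sigma x).

Definition chart_diff (xi x : n.-tuple R) : 'cV[R]_n :=
  \col_i (l (tnth x i) - l (tnth xi i)).

Hypothesis pdfE : forall xi sigma x, X x -> pdf xi sigma x =
  expR (- 2^-1 * quadform sigma (chart_diff xi x)) /
  (Num.sqrt ((2 * pi) ^+ n * \det sigma ^+ 2) * \prod_i w (tnth x i)).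

Let delta xi sigma : {measure set (n.-tuple R) -> \bar R} :=
  mdensity tl mX (mpdf xi sigma) (@pdf0 xi sigma).

Let norm_gt0 (sigma : 'M[R]_n) : symmetric_nonsingular sigma ->
  0 < Num.sqrt ((2 * pi) ^+ n * \det sigma ^+ 2).
Proof.
move=> [_]; rewrite unitmxE unitfE => det0.
rewrite sqrtr_gt0 mulr_gt0//; first by rewrite exprn_gt0// mulr_gt0// pi_gt0.
by rewrite exprn_even_gt0.
Qed.

Let mono_prodE (alpha : I) (m : 'I_n -> R) s x : X x ->
  monomial alpha x *
    \prod_i (normal_pdf (m i) s (l (tnth x i)) / w (tnth x i)) =
  \prod_i (tnth x i ^+ val alpha i *
    (normal_pdf (m i) s (l (tnth x i)) / w (tnth x i))).
Proof. by rewrite -big_split. Qed.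

Let integrable_prod (alpha : I) (m : 'I_n -> R) s : s != 0 ->
  tl.-integrable X (EFin \o (fun x => \prod_i (tnth x i ^+ val alpha i *
    (normal_pdf (m i) s (l (tnth x i)) / w (tnth x i))))).
Proof.
move=> s0; rewrite XE.
apply: (integrable_tuple_lebesgue_prod (f := fun i x =>
  x ^+ val alpha i * (normal_pdf (m i) s (l x) / w x))) => // i.
exact: int1.
Qed.

Let measurable_mon (alpha : I) : measurable_fun X (@monomial R n d alpha).
Proof. by apply: measurable_funTS; exact: measurable_monomial. Qed.

(** Coercivity dominates the density by a multiple of a product of one-dimensional densities with
    variance [1 / c]; [K] exchanges the two normalising constants. *)
Let integrable_pdf xi sigma (alpha : I) : symmetric_nonsingular sigma ->
  tl.-integrable X (EFin \o (fun x => monomial alpha x * pdf xi sigma x)).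
Proof.
move=> ssigma; have [c c0 cq] := quadform_coercive ssigma.
pose s := Num.sqrt c^-1.
have s0 : s != 0 by rewrite gt_eqF// sqrtr_gt0 invr_gt0.
pose m i := l (tnth xi i).
set Z := Num.sqrt ((2 * pi) ^+ n * \det sigma ^+ 2).
have Z0 : 0 < Z by exact: norm_gt0.
have p0 : 0 < normal_peak s by exact: normal_peak_gt0.
pose K := Z^-1 * (normal_peak s)^-1 ^+ n.
apply: le_integrable (integrableZl mX K (integrable_prod alpha m s0)) => //.
  by apply/measurable_EFinP; exact: measurable_funM.
move=> x Xx; rewrite /= lee_fin -mono_prodE// mulrCA.
rewrite [leLHS]normrM [leRHS]normrM ler_wpM2l//.
rewrite (normrM K).
rewrite (ger0_norm (pdf0 _ _ Xx)) pdfE//.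
have Dx i : D (tnth x i) by move: Xx; rewrite XE.
have W0 : 0 < \prod_i w (tnth x i) by apply: prodr_gt0 => i _; exact: w0.
have K0 : 0 <= K by apply: mulr_ge0; [|apply: exprn_ge0]; rewrite invr_ge0 ltW.
have P0 : 0 <= (\prod_i normal_pdf (m i) s (l (tnth x i))) /
    \prod_i w (tnth x i).
  apply: divr_ge0; last exact: ltW.
  by apply: prodr_ge0 => i _; exact: normal_pdf_ge0.
rewrite big_split/= prodfV (ger0_norm K0) (ger0_norm P0).
have Wi0 : 0 <= (\prod_i w (tnth x i))^-1 by rewrite invr_ge0 ltW.
rewrite invfM /K mulrA [leRHS]mulrA (ler_wpM2r Wi0)//.
have Zi0 : 0 <= Z^-1 by rewrite invr_ge0 ltW.
rewrite [leLHS]mulrC -[leRHS]mulrA (ler_wpM2l Zi0)//.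
rewrite -[n in X in _ <= X * _]card_ord -prodr_const -big_split/=.
apply: (@le_trans _ _ (expR (- 2^-1 * (c * \sum_i chart_diff xi x i 0 ^+ 2)))).
  by rewrite ler_expR !mulNr lerN2 ler_wpM2l.
rewrite !mulr_sumr expR_sum; apply: ler_prod => i _; rewrite expR_ge0/=.
rewrite normal_pdfE//= mulKf ?gt_eqF// /normal_fun ler_expR mxE -/(m i).
have -> : s ^+ 2 = c^-1 by rewrite sqr_sqrtr// invr_ge0 ltW.
rewrite le_eqVlt; apply/orP; left; apply/eqP.
by field; rewrite gt_eqF.
Qed.

Let pdf_lower xi sigma : symmetric_nonsingular sigma ->
  exists2 g0 : R, 0 < g0 & forall x, cube n J x -> g0 <= pdf xi sigma x.
Proof.
(* [V] bounds the coordinates of [chart_diff] on the cube, where [|l x| <= 2]; there [w <= 2]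
   accounts for the factor [2 ^+ n] in [g0]. *)
move=> ssigma; pose V := 2 + \sum_i `|l (tnth xi i)|.
have [Q qQ] := quadform_bounded sigma V.
have Z0 := norm_gt0 ssigma; set Z := Num.sqrt _ in Z0.
exists (expR (- 2^-1 * Q) / (Z * 2 ^+ n)).
  by rewrite divr_gt0 ?expR_gt0// mulr_gt0// exprn_gt0.
move=> x Jx; have Xx : X x by rewrite XE => i; exact/JD/Jx.
have Dx i : D (tnth x i) by exact/JD/Jx.
have W0 : 0 < \prod_i w (tnth x i) by apply: prodr_gt0 => i _; exact: w0.
rewrite pdfE// -/Z; apply: ler_pM; first exact: expR_ge0.
- by rewrite invr_ge0 mulr_ge0 ?exprn_ge0// ltW.
- rewrite ler_expR !mulNr lerN2 ler_wpM2l// qQ// => i; rewrite mxE.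
  apply: (le_trans (ler_normB _ _)); rewrite lerD ?lJ//.
  by rewrite (bigD1 i)//= lerDl sumr_ge0.
rewrite lef_pV2 ?posrE ?mulr_gt0 ?exprn_gt0// (ler_wpM2l (ltW Z0))//.
rewrite -[n in X in _ <= X]card_ord -prodr_const.
by apply: ler_prod => i _; rewrite ltW ?w0//= wJ.
Qed.

Lemma chart_interior_mixtures : interior_mixtures X (@monomial R n d) delta.
Proof.
move=> xi sigma _ ssigma; have [g0 g0_gt0 pdfg0] := pdf_lower xi ssigma.
apply: (@moment_cone_interior _ _ _ X _ mX _ _ g0) => //.
  by rewrite XE => x Jx i; exact/JD/Jx.
by move=> alpha; exact: integrable_pdf.
Qed.

Let pdf_scalarE xi e x : 0 < e -> X x -> pdf xi e%:M x =
  \prod_i (normal_pdf (l (tnth xi i)) e (l (tnth x i)) / w (tnth x i)).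
Proof.
move=> e0 Xx; have en0 : e != 0 by rewrite gt_eqF.
rewrite pdfE// quadform_scalar// det_scalar big_split/= prodfV.
rewrite [(_ * \prod_i _)^-1]invfM mulrA; congr (_ * _).
under [RHS]eq_bigr do rewrite normal_pdfE//.
rewrite big_split/= prodr_const card_ord mulrC; congr (_ * _).
  have -> : (2 * pi) ^+ n * (e ^+ n) ^+ 2 =
      (Num.sqrt (e ^+ 2 * pi *+ 2) ^+ n) ^+ 2.
    rewrite -!exprM [(n * 2)%N]mulnC !exprM sqr_sqrtr -?exprMn; last first.
      by rewrite mulrn_wge0// mulr_ge0 ?sqr_ge0 ?pi_ge0.
    by congr (_ ^+ _); ring.
  by rewrite sqrtr_sqr ger0_norm ?exprn_ge0// /normal_peak exprVn.
rewrite -expR_sum /normal_fun !mulr_sumr; congr expR; apply: eq_bigr => i _.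
by rewrite mxE; field.
Qed.

Lemma chart_mixture_vector xi e (alpha : I) : 0 < e ->
  mixture_vector X (@monomial R n d) delta xi e%:M alpha =
  \prod_i \int[leb]_(x in D) (x ^+ val alpha i *
    (normal_pdf (l (tnth xi i)) e (l x) / w x)).
Proof.
move=> e0; have en0 : e != 0 by rewrite gt_eqF.
rewrite /mixture_vector Rintegral_mdensity//; last first.
  exact/integrable_pdf/symmetric_nonsingular_scalar.
have := Rintegral_tuple_lebesgue_prod mD
  (fun i => int1 (l (tnth xi i)) (val alpha i) en0).
rewrite -XE => <-; apply: eq_Rintegral => x /[!inE] Xx.
by rewrite pdf_scalarE// mono_prodE.
Qed.

(** The one-dimensional form of [T_e]: a lower triangular matrix near the identity, independent of
    the point [y]. Entries of [A] with [b > k] are left arbitrary. *)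
Hypothesis scalar_moments : forall eta : R, 0 < eta ->
  exists (e : R) (A : nat -> nat -> R), [/\ 0 < e,
    forall k b, (b <= k <= d)%N -> `|A k b - (k == b)%:R| <= eta &
    forall k (y : R), (k <= d)%N -> D y ->
      \int[leb]_(x in D) (x ^+ k * (normal_pdf (l y) e (l x) / w x)) =
      \sum_(b < k.+1) A k b * y ^+ b].

Lemma chart_approximate_diracs : approximate_diracs X (@monomial R n d) delta.
Proof.
move=> eta eta0.
(* [near_prod] requires a tolerance at most 1 and multiplies it by [2 ^+ n]. *)
pose eta' := Num.min 1 (eta / 2 ^+ n).
have eta'0 : 0 < eta' by rewrite lt_min ltr01 divr_gt0// exprn_gt0.
have [e [A [e0 Anear AE]]] := scalar_moments eta'0.
pose A' k b := if (b <= k)%N then A k b else 0.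
exists e%:M, (fun alpha beta : I => \prod_i A' (val alpha i) (val beta i)).
split=> [|alpha beta|y Xy alpha].
- by apply: symmetric_nonsingular_scalar; rewrite gt_eqF.
- rewrite multiindex_eqE.
  apply: (@le_trans _ _ (2 ^+ n * eta')).
    apply: near_prod => [|i|i].
    + by rewrite ltW//= ge_min lexx.
    + by case: eqP => _; rewrite ?normr1 ?normr0.
    + rewrite /A'; case: leqP => [ba|ab].
        by apply: Anear; rewrite ba -ltnS ltn_ord.
      rewrite (_ : (_ == _) = false) ?subrr ?normr0 ?ltW//.
      by apply/eqP => h; rewrite h ltnn in ab.
  by rewrite mulrC -ler_pdivlMr ?exprn_gt0// ge_min lexx orbT.
rewrite chart_mixture_vector//.
have Dy i : D (tnth y i) by move: Xy; rewrite XE.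
transitivity (\prod_i \sum_(b < d.+1) A' (val alpha i) b * tnth y i ^+ b).
  apply: eq_bigr => i _; rewrite AE -1?ltnS//.
  rewrite (big_ord_widen d.+1 (fun b => A (val alpha i) b * tnth y i ^+ b))//.
  rewrite big_mkcond; apply: eq_bigr => b _.
  by rewrite ltnS /A'; case: ifP; rewrite ?mul0r.
rewrite bigA_distr_bigA/=.
(* An exponent [f] of total degree above [d] exceeds [alpha] in some coordinate, where the
   triangular [A'] vanishes; only indices in [I] survive. *)
rewrite (bigID (fun f : {ffun 'I_n -> 'I_d.+1} => (\sum_i f i <= d)%N))/=.
rewrite [X in _ + X]big1 ?addr0; last first.
  move=> f df; have [i fi] : exists i, (val alpha i < f i)%N.
    apply/existsP; apply: contraR df; rewrite negb_exists => /forallP h.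
    apply: leq_trans (valP alpha); apply: leq_sum => i _.
    by rewrite leqNgt h.
  by rewrite (bigD1 i)//= /A' leqNgt fi/= !mul0r.
rewrite (@big_sub _ _ _ _
  (fun f : {ffun 'I_n -> 'I_d.+1} => (\sum_i f i <= d)%N)
  (fun f => \prod_i (A' (val alpha i) (f i) * tnth y i ^+ f i))).
by apply: eq_bigr => beta _; rewrite big_split.
Qed.

Lemma chart_mixture_caratheodory_le :
  (mixture_caratheodory X (@monomial R n d) delta <=
   caratheodory X (@monomial R n d))%E.
Proof.
apply: mixture_caratheodory_le => //.
  exact: chart_interior_mixtures.
exact: chart_approximate_diracs.
Qed.

End charts.

Section scalar_moments.
Context {R : realType}.
Local Notation leb := (@lebesgue_measure R).

(** The diagonal entries are exactly 1, and an entry with [b < k] carries the factor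
    [e ^+ (k - b) <= e]; [K] bounds the remaining factors for all [k, b <= d]. *)
Lemma gaussian_scalar_moments d (eta : R) : 0 < eta ->
  exists (e : R) (A : nat -> nat -> R), [/\ 0 < e,
    forall k b, (b <= k <= d)%N -> `|A k b - (k == b)%:R| <= eta &
    forall k (y : R), (k <= d)%N ->
      \int[leb]_x (x ^+ k * normal_pdf y e x) = \sum_(b < k.+1) A k b * y ^+ b].
Proof.
move=> eta0; pose mom k := \int[leb]_x (x ^+ k * normal_pdf 0 1 x).
have mom0 : mom 0%N = 1.
  rewrite /mom; under eq_Rintegral do rewrite expr0 mul1r.
  by rewrite /Rintegral integral_normal_pdf.
pose T k b := 'C(k, b)%:R * `|mom (k - b)%N|.
have T0 k b : 0 <= T k b by rewrite mulr_ge0.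
pose K := 1 + \sum_(k < d.+1) \sum_(b < d.+1) T k b.
have TK k b : (k <= d)%N -> (b <= d)%N -> T k b <= K.
  move=> kd bd; pose k' : 'I_d.+1 := Ordinal (kd : (k < d.+1)%N).
  pose b' : 'I_d.+1 := Ordinal (bd : (b < d.+1)%N).
  rewrite /K (bigD1 k')//= (bigD1 b')//=.
  set S1 := \sum_(i < d.+1 | i != b') _; set S2 := \sum_(i < d.+1 | i != k') _.
  have S1_ge0 : 0 <= S1 by apply: sumr_ge0.
  have S2_ge0 : 0 <= S2 by apply: sumr_ge0 => i _; exact: sumr_ge0.
  lra.
have K0 : 0 < K.
  by rewrite ltr_pwDl// sumr_ge0// => ? _; apply: sumr_ge0.
pose e := Num.min 1 (eta / K).
have e0 : 0 < e by rewrite lt_min ltr01 divr_gt0.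
have e1 : e <= 1 by rewrite ge_min lexx.
exists e, (fun k b => 'C(k, b)%:R * e ^+ (k - b) * mom (k - b)%N); split => //.
  move=> k b /andP[bk kd]; have [<-|kb] := eqVneq k b.
    by rewrite subnn binn expr0 mom0 !mulr1 subrr normr0 ltW.
  rewrite subr0 mulrAC normrM normrM [`|_%:R|]ger0_norm// -/(T k b).
  rewrite (ger0_norm (exprn_ge0 _ (ltW e0))).
  apply: (@le_trans _ _ (K * e)).
    apply: ler_pM => //; first by rewrite exprn_ge0// ltW.
      by apply: TK => //; exact: leq_trans kd.
    rewrite -[leRHS]expr1; apply: ler_wiXn2l => //; first exact: ltW.
    by rewrite subn_gt0 ltn_neqAle eq_sym kb.
  by rewrite mulrC -ler_pdivlMr// ge_min lexx orbT.
by move=> k y kd; rewrite Rintegral_exprn_normal_pdf.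
Qed.

(** Here the matrix is diagonal: the [k]-th moment is [y ^+ k] times a factor depending only on [k]
    and [e]. *)
Lemma lognormal_scalar_moments d (eta : R) : 0 < eta ->
  exists (e : R) (A : nat -> nat -> R), [/\ 0 < e,
    forall k b, (b <= k <= d)%N -> `|A k b - (k == b)%:R| <= eta &
    forall k (y : R), (k <= d)%N -> 0 < y ->
      \int[leb]_(x in `]0, +oo[) (x ^+ k * (normal_pdf (ln y) e (ln x) / x)) =
      \sum_(b < k.+1) A k b * y ^+ b].
Proof.
move=> eta0; pose L : R := ln (1 + eta).
have L0 : 0 < L by rewrite ln_gt0// ltrDl.
(* The variance [c = e ^+ 2] makes [k ^+ 2 * c / 2 <= L = ln (1 + eta)] for every [k <= d], so the
   diagonal factor is at most [1 + eta]. *)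
pose c := 2 * L / (d%:R ^+ 2 + 1).
have d0 : 0 < d%:R ^+ 2 + 1 :> R by rewrite ltr_wpDl// sqr_ge0.
have c0 : 0 < c by rewrite divr_gt0// mulr_gt0.
exists (Num.sqrt c), (fun k b => (k == b)%:R * expR (k%:R ^+ 2 * c / 2)).
split; first by rewrite sqrtr_gt0.
  move=> k b /andP[bk kd]; have [_|_] := eqVneq k b; last first.
    by rewrite mul0r subrr normr0 ltW.
  have q0 : 0 <= k%:R ^+ 2 * c / 2.
    by rewrite divr_ge0// mulr_ge0 ?sqr_ge0// ltW.
  rewrite mul1r ger0_norm; last first.
    by rewrite subr_ge0; apply: le_trans (expR_ge1Dx _); rewrite lerDl.
  rewrite lerBlDl -[1 + eta]lnK ?posrE ?addr_gt0// ler_expR -/L.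
  have kd2 : k%:R ^+ 2 <= d%:R ^+ 2 + 1 :> R.
    apply: (@le_trans _ _ (d%:R ^+ 2)); last by rewrite lerDl.
    by rewrite lerXn2r ?nnegrE// ler_nat.
  rewrite ler_pdivrMr// mulrA ler_pdivrMr// mulrC [L * 2]mulrC.
  by rewrite ler_wpM2l// mulr_ge0// ltW.
move=> k y kd y0; rewrite Rintegral_exprn_lognormal_pdf ?gt_eqF ?sqrtr_gt0//.
rewrite big_ord_recr/= big1 ?add0r; last first.
  by move=> b _; rewrite gtn_eqF// !mul0r.
by rewrite eqxx mul1r expRD expRM_natl lnK ?posrE// sqr_sqrtr ?ltW// mulrC.
Qed.

End scalar_moments.

Theorem theorem34 (R : realType) (n d : nat) (hn : (0 < n)%N) (hd : (0 < d)%N) :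
  (mixture_caratheodory [set: n.-tuple R]
      (@monomial R n d) (@gaussian_measure R n)
    <= caratheodory [set: n.-tuple R] (@monomial R n d))%E
  /\
  (mixture_caratheodory (@posorthant R n)
      (@monomial R n d) (@lognormal_measure R n)
    <= caratheodory (@posorthant R n) (@monomial R n d))%E.
Proof.
have J12 (x : R) : `[1%:R : R, 2%:R : R]%classic x -> 1 <= x <= 2.
  by rewrite /= in_itv.
split.
- apply: (chart_mixture_caratheodory_le (D := setT) (l := id) (w := fun=> 1)).
  + exact: measurableT.
  + by [].
  + by move=> x _; exact: ltr01.
  + by move=> x /J12/andP[x1 x2]; rewrite ger0_norm// (le_trans ler01).
  + by move=> x _; rewrite ler1n.
  + move=> m s k s0; under [X in EFin \o X]funext do rewrite divr1.
    exact: integrable_exprn_normal_pdf.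
  + by rewrite predeqE.
  + move=> xi sigma x _; rewrite /gaussian_pdf big1// mulr1.
    congr (expR (_ * quadform _ _) / _).
    by apply/colP => i; rewrite !mxE.
  + move=> eta /(gaussian_scalar_moments d)[e [A [e0 Anear AE]]].
    exists e, A; split => // k y kd _; rewrite -AE//.
    by apply: eq_Rintegral => x _; rewrite divr1.
- apply: (chart_mixture_caratheodory_le
    (D := `]0, +oo[%classic) (l := @ln R) (w := id)).
  + exact: measurable_itv.
  + by move=> x /J12/andP[x1 _]; rewrite /= in_itv/= andbT (lt_le_trans ltr01).
  + by move=> x; rewrite /= in_itv/= andbT.
  + move=> x /J12/andP[x1 x2]; rewrite ger0_norm ?ln_ge0//.
    (* From [1 + ln x <= x <= 2], the logarithm is at most 1 on [[1, 2]]. *)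
    have := expR_ge1Dx (ln x); rewrite lnK ?posrE ?(lt_le_trans ltr01)//.
    by move: x2; lra.
  + by move=> x /J12/andP[].
  + by move=> m s k; exact: integrable_exprn_lognormal_pdf.
  + rewrite predeqE => x.
    by split=> x0 i; have := x0 i; rewrite /= in_itv/= andbT.
  + move=> xi sigma x _; rewrite /lognormal_pdf.
    congr (expR (_ * quadform _ _) / _).
    by apply/colP => i; rewrite !mxE !tnth_mktuple.
  + move=> eta /(lognormal_scalar_moments d)[e [A [e0 Anear AE]]].
    exists e, A; split => // k y kd; rewrite /= in_itv/= andbT => y0.
    exact: AE.
Qed.
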